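(* Let $N$ be a positive integer and consider the equation $$v^N_t=iv^N_{xx}-P_N\big((v^N)^2\overline{v^N_x}\big)+\frac i2P_N\big(|v^N|^4v^N\big)-i\psi(v^N)v^N-im(v^N)P_N\big(|v^N|^2v^N\big)$$ for $v^N=P_Nv^N$ on $\mathbb{T}$, written as a system of ODEs for the Fourier coefficients $c_j=\widehat{v^N}(j)=a_j+ib_j$, $|j|\le N$. The Lebesgue measure $\prod_{|j|\le N}da_j\,db_j$ on $\mathbb{R}^{4N+2}$ is invariant under the flow of this system of ODEs.
   Context: $\mathbb{T}=\mathbb{R}/2\pi\mathbb{Z}$, $v^N(x)=\sum_{|j|\le N}c_je^{ijx}$ with $c_j=a_j+ib_j$, $P_Nf=\sum_{|n|\le N}\widehat f(n)e^{inx}$. $m(v)=\frac1{2\pi}\int_{\mathbb{T}}|v|^2dx$ and $\psi(v)=-\frac1\pi\int_{\mathbb{T}}\mathrm{Im}(v\overline v_x)dx+\frac1{4\pi}\int_{\mathbb{T}}|v|^4dx-m(v)^2$. *)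

(* Defs.v *)
From HB Require Import structures.
From mathcomp Require Import all_boot all_order all_algebra.
From mathcomp Require Import all_classical all_reals all_analysis.
From mathcomp Require Import complex.

Set Implicit Arguments.
Unset Strict Implicit.
Unset Printing Implicit Defensive.

Import Order.TTheory GRing.Theory Num.Theory.
Import numFieldNormedType.Exports.
Import ComplexField.Normc.

Local Open Scope classical_set_scope.
Local Open Scope ring_scope.
Local Open Scope complex_scope.

(** n-fold power of a sigma-finite measure, on the product sigma-algebra that
    the library puts on n-tuples. *)

Section tuple_measure.
Context (R : realType) (d : measure_display) (T : measurableType d).

Definition tcons (n : nat) (p : T * n.-tuple T) : n.+1.-tuple T :=
  [tuple of p.1 :: p.2].

Lemma measurable_tcons (n : nat) : measurable_fun [set: T * n.-tuple T] (@tcons n).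
Proof. exact: measurable_cons. Qed.

Section step.
Context (n : nat) (mu : {sigma_finite_measure set T -> \bar R}).
Variable nu : {sigma_finite_measure set (n.-tuple T) -> \bar R}.

Definition tuple_measureS : set (n.+1.-tuple T) -> \bar R :=
  pushforward (mu \x nu)%E (@tcons n).

Let preimage_tconsM (A : set (n.+1.-tuple T)) :
  measurable A -> measurable (@tcons n @^-1` A).
Proof. by move=> mA; rewrite -[X in measurable X]setTI; exact: measurable_tcons. Qed.

Let tuple_measureS0 : tuple_measureS set0 = 0%E.
Proof. by rewrite /tuple_measureS /pushforward preimage_set0 measure0. Qed.

Let tuple_measureS_ge0 A : (0 <= tuple_measureS A)%E.
Proof. exact: integral_ge0. Qed.

Let tuple_measureS_sigma_additive : semi_sigma_additive tuple_measureS.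
Proof.
move=> F mF tF mUF; rewrite /tuple_measureS /pushforward preimage_bigcup.
apply: measure_semi_sigma_additive.
- by move=> k; exact: preimage_tconsM.
- by apply/trivIsetP => /= i j _ _ ij; rewrite -preimage_setI;
    move/trivIsetP : tF => /(_ _ _ _ _ ij) ->//; rewrite preimage_set0.
- by rewrite -preimage_bigcup; exact: preimage_tconsM.
Qed.

HB.instance Definition _ := isMeasure.Build _ _ _ tuple_measureS
  tuple_measureS0 tuple_measureS_ge0 tuple_measureS_sigma_additive.

Let tuple_measureS_sigma_finite : sigma_finite setT tuple_measureS.
Proof.
have /sigma_finiteP[F [TF ndF Foo]] := sigma_finiteT mu.
have /sigma_finiteP[G [TG ndG Goo]] := sigma_finiteT nu.
pose g (t : n.+1.-tuple T) : T * n.-tuple T := (thead t, [tuple of behead t]).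
have mg : measurable_fun setT g.
  by apply/measurable_fun_pairP; split;
    [exact: measurable_tnth|exact: measurable_behead].
have gK : cancel (@tcons n) g.
  by move=> [x t]; rewrite /g /tcons/= theadE; congr pair; exact/val_inj.
exists (fun k => g @^-1` (F k `*` G k)).
  rewrite -preimage_bigcup (_ : \bigcup_k _ = setT) ?preimage_setT//.
  rewrite -setXTT TF TG predeqE => -[x y]; split.
    by move=> [k _ []/= ? ?]; split; exists k.
  move=> [/= [i _ Fix] [j _ Gjy]]; exists (maxn i j) => //; split.
  - by move: x Fix; exact/subsetPset/ndF/leq_maxl.
  - by move: y Gjy; exact/subsetPset/ndG/leq_maxr.
move=> k; have [mF Fk] := Foo k; have [mG Gk] := Goo k; split.
  by rewrite -[X in measurable X]setTI; apply: mg => //; exact: measurableX.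
rewrite /tuple_measureS /pushforward (_ : _ @^-1` _ = F k `*` G k).
  by rewrite product_measure1E// lte_mul_pinfty// ge0_fin_numE.
by apply/funext => p; rewrite /preimage /mkset gK.
Qed.

HB.instance Definition _ := Measure_isSigmaFinite.Build _ _ _ tuple_measureS
  tuple_measureS_sigma_finite.
End step.

Fixpoint tuple_measure (mu : {sigma_finite_measure set T -> \bar R}) (n : nat) :
    {sigma_finite_measure set (n.-tuple T) -> \bar R} :=
  match n with
  | 0 => [the {sigma_finite_measure set _ -> \bar R} of \d_([tuple] : 0.-tuple T)]
  | m.+1 => [the {sigma_finite_measure set _ -> \bar R}
             of tuple_measureS mu (tuple_measure mu m)]
  end.

Lemma tuple_measure_box (mu : {sigma_finite_measure set T -> \bar R}) (n : nat)
    (A : 'I_n -> set T) : (forall i, measurable (A i)) ->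
  tuple_measure mu n [set t | forall i, A i (tnth t i)] =
  (\prod_(i < n) mu (A i))%E.
Proof.
elim: n A => [|n IHn] A mA.
  rewrite big_ord0 /= diracE (_ : _ \in _) //.
  by rewrite inE /= => -[].
rewrite big_ord_recl /= /tuple_measureS /pushforward.
rewrite (_ : _ @^-1` _ =
    A ord0 `*` [set t | forall i, A (lift ord0 i) (tnth t i)]); last first.
  apply/seteqP; split=> -[x t] /=.
    move=> h; split; first by have := h ord0; rewrite tnth0.
    by move=> i; have := h (lift ord0 i); rewrite tnthS.
  by case=> h0 h i; case: (unliftP ord0 i) => [j|] ->; rewrite ?tnthS ?tnth0.
rewrite product_measure1E//; first by congr (_ * _)%E; exact: IHn.
have -> : [set t : n.-tuple T | forall i, A (lift ord0 i) (tnth t i)] =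
    \bigcap_(i in [set: 'I_n]) ((@tnth _ T ^~ i) @^-1` A (lift ord0 i)).
  by apply/seteqP; split=> t /=; [move=> h i _; exact: h|move=> h i; exact: h].
apply: fin_bigcap_measurable; first exact: finite_finset.
by move=> i _; rewrite -[X in measurable X]setTI; exact: measurable_tnth.
Qed.
End tuple_measure.

(** Functions on the circle are functions on the line, integrated over [0, 2 pi]. *)

Section circle.
Context (R : realType).

Definition circle_int (f : R -> R) : R :=
  \int[@lebesgue_measure R]_(x in `[0, 2 * pi]) f x.

Definition circle_intC (f : R -> R[i]) : R[i] :=
  circle_int (fun x => complex.Re (f x)) +i* circle_int (fun x => complex.Im (f x)).

Definition dx (f : R -> R[i]) (x : R) : R[i] :=
  derive1 (fun y => complex.Re (f y)) x +i* derive1 (fun y => complex.Im (f y)) x.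

Definition cexp (n : int) (x : R) : R[i] := cos (n%:~R * x) +i* sin (n%:~R * x).

Definition fourier (f : R -> R[i]) (n : int) : R[i] :=
  ((2 * pi)^-1)%:C * circle_intC (fun x => f x * cexp (- n) x).

(** [mode N] enumerates the integers j with |j| <= N. *)
Definition mode (N : nat) (k : 'I_(2 * N).+1) : int := k%:Z - N%:Z.

Definition PN (N : nat) (f : R -> R[i]) (x : R) : R[i] :=
  \sum_(k < (2 * N).+1) fourier f (mode k) * cexp (mode k) x.

Definition mass (v : R -> R[i]) : R :=
  (2 * pi)^-1 * circle_int (fun x => normc (v x) ^+ 2).

Definition psi (v : R -> R[i]) : R :=
  - pi^-1 * circle_int (fun x => complex.Im (v x * ((dx v x)^*)%C))
  + (4 * pi)^-1 * circle_int (fun x => normc (v x) ^+ 4)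
  - mass v ^+ 2.

Definition rhs (N : nat) (v : R -> R[i]) (x : R) : R[i] :=
  'i%C * dx (dx v) x
  - PN N (fun y => v y ^+ 2 * ((dx v y)^*)%C) x
  + 'i%C / 2 * PN N (fun y => (normc (v y) ^+ 4)%:C * v y) x
  - 'i%C * (psi v)%:C * v x
  - 'i%C * (mass v)%:C * PN N (fun y => (normc (v y) ^+ 2)%:C * v y) x.

End circle.

(** The coefficients c_j = a_j + i b_j, |j| <= N, as a point of
    R^(2N+1) * R^(2N+1) = R^(4N+2). *)

Section coefficients.
Context (R : realType) (N : nat).

Definition coefs : Type :=
  ((2 * N).+1.-tuple (measurableTypeR R) * (2 * N).+1.-tuple (measurableTypeR R))%type.

Definition coef (c : coefs) (k : 'I_(2 * N).+1) : R[i] :=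
  (tnth c.1 k : R) +i* (tnth c.2 k : R).

Definition trigpoly (c : coefs) (x : R) : R[i] :=
  \sum_(k < (2 * N).+1) coef c k * cexp (mode k) x.

Definition ode_field (c : coefs) (k : 'I_(2 * N).+1) : R[i] :=
  fourier (rhs N (trigpoly c)) (mode k).

Definition is_solution (u : R -> coefs) : Prop :=
  forall (t : R) (k : 'I_(2 * N).+1),
    is_derive t 1 (fun s => complex.Re (coef (u s) k))
      (complex.Re (ode_field (u t) k)) /\
    is_derive t 1 (fun s => complex.Im (coef (u s) k))
      (complex.Im (ode_field (u t) k)).

(** A solution through each c, for all times of both signs.  The field is
    polynomial in (a, b) and conserves [mass (trigpoly c)], so such a [Phi]
    exists and is unique. *)
Definition is_flow (Phi : R -> coefs -> coefs) : Prop :=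
  forall c : coefs, Phi 0 c = c /\ is_solution (Phi ^~ c).

Definition lebesgue_coefs : set coefs -> \bar R :=
  (tuple_measure (@lebesgue_measure R) (2 * N).+1
   \x tuple_measure (@lebesgue_measure R) (2 * N).+1)%E.

Definition invariant_under (Phi : R -> coefs -> coefs) : Prop :=
  forall t : R, measurable_fun [set: coefs] (Phi t) /\
    forall A : set coefs, measurable A ->
      lebesgue_coefs (Phi t @^-1` A) = lebesgue_coefs A.

End coefficients.

(* Main.v *)
(** Liouville's theorem without a multidimensional change of variables.

    The divergence of the field and the conservation of the mass are read off
    at the level of functions of x: d/dc_k of a Fourier coefficient of a
    product is again a Fourier coefficient, so every term of the divergence is
    either i times the mean of a real function, or has as real part the mean of
    an x-derivative.

    Given a Lipschitz compactly supported [phi], put [psi = phi o Phi_t], which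
    is again Lipschitz by Gronwall and compactly supported because the mass is
    conserved.  Up to O(s^2) the map [Phi_s] is a composition of maps
    [x |-> x + s X_i(x) e_i], each moving one coordinate.  For such a map, Fubini
    and the one-dimensional fundamental theorem of calculus (applied to a
    primitive of [psi] along the coordinate) give exactly
      int (psi o S) (1 + s d_i X_i) = int psi.
    Summing over the coordinates, the terms of order s add up to
    [- s int psi div X = 0].  Hence [t |-> int phi o Phi_t] has derivative zero,
    and approximating indicators of boxes by such [phi] gives the invariance. *)

Require Import Defs.
From mathcomp Require Import all_boot all_order all_algebra.
From mathcomp Require Import all_classical all_reals all_analysis.
From mathcomp Require Import complex measurable_realfun.
From mathcomp Require Import ring lra.

Set Implicit Arguments.
Unset Strict Implicit.
Unset Printing Implicit Defensive.

Import Order.TTheory GRing.Theory Num.Theory.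
Import numFieldNormedType.Exports.

Local Open Scope classical_set_scope.
Local Open Scope ring_scope.

(** * Phase space *)

Section phase_space.
Context (R : realType) (n : nat).

(** Two losses of uniformity shape the proof. The field is polynomial, so it is bounded and
    Lipschitz only on cubes: shears use it composed with the projection onto a cube, and all test
    functions vanish off a smaller cube, so that the projection is never felt. Gronwall is uniform
    only on balls: a compactly supported test function is what makes its composition with the flow
    globally Lipschitz. Lipschitz test functions suffice because only differences of values are
    estimated: an error O(s^2) in the point becomes O(s^2) in the integral. Polynomials are kept as
    syntax. A partial derivative is then again a polynomial, and its bounds, slices and algebra come
    for free. In the divergence the delicate terms are the factors $\psi(v)$ and $m(v)$, which
    themselves depend on every coefficient. Their derivatives are controlled only after summation
    over all modes: the one by gauge invariance, the other by pairing with $\overline v$. *)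

Definition phase : Type :=
  (n.-tuple (measurableTypeR R) * n.-tuple (measurableTypeR R))%type.

(* [inl k] is the coordinate a_k and [inr k] the coordinate b_k. *)
Definition coord (i : 'I_n + 'I_n) (x : phase) : R :=
  match i with inl k => tnth x.1 k | inr k => tnth x.2 k end.

Definition mkpt (f : 'I_n + 'I_n -> R) : phase :=
  ([tuple f (inl k) | k < n], [tuple f (inr k) | k < n]).

Lemma coord_mkpt f i : coord i (mkpt f) = f i.
Proof. by case: i => k /=; rewrite tnth_mktuple. Qed.

Lemma eq_phase (x y : phase) : (forall i, coord i x = coord i y) -> x = y.
Proof.
move: x y => [x1 x2] [y1 y2] h; congr pair; apply: eq_from_tnth => k.
- exact: (h (inl k)).
- exact: (h (inr k)).
Qed.

Definition upd (x : phase) i (y : R) : phase :=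
  mkpt (fun j => if j == i then y else coord j x).

Lemma coord_upd x i y j : coord j (upd x i y) = if j == i then y else coord j x.
Proof. exact: coord_mkpt. Qed.

Lemma upd_upd x i y z : upd (upd x i y) i z = upd x i z.
Proof. by apply: eq_phase => j; rewrite !coord_upd; case: eqP. Qed.

Lemma upd_id x i : upd x i (coord i x) = x.
Proof. by apply: eq_phase => j; rewrite coord_upd; case: eqP => // ->. Qed.

Definition dist1 (x y : phase) : R := \sum_i `|coord i x - coord i y|.

Lemma dist1_ge0 x y : 0 <= dist1 x y.
Proof. exact: sumr_ge0. Qed.

Lemma dist1C x y : dist1 x y = dist1 y x.
Proof. by apply: eq_bigr => i _; rewrite distrC. Qed.

Lemma dist1xx x : dist1 x x = 0.
Proof. by apply: big1 => i _; rewrite subrr normr0. Qed.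

Lemma dist1_triangle y x z : dist1 x z <= dist1 x y + dist1 y z.
Proof.
rewrite -big_split /=; apply: ler_sum => i _.
by rewrite (le_trans _ (ler_normD _ _))// addrA subrK.
Qed.

Lemma ler_coord_dist1 i x y : `|coord i x - coord i y| <= dist1 x y.
Proof. by rewrite /dist1 (bigD1 i)//= lerDl sumr_ge0. Qed.

Lemma dist1_upd x i y z : dist1 (upd x i y) (upd x i z) = `|y - z|.
Proof.
rewrite /dist1 (bigD1 i)//= !coord_upd eqxx big1 ?addr0// => j /negbTE ji.
by rewrite !coord_upd ji subrr normr0.
Qed.

Lemma dist1_updl x i y : dist1 (upd x i y) x = `|y - coord i x|.
Proof. by rewrite -{2}(upd_id x i) dist1_upd. Qed.

Definition cube (B : R) : set phase := [set x | forall i, `|coord i x| <= B].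

Lemma cube_mono B C : B <= C -> cube B `<=` cube C.
Proof. by move=> BC x h i; rewrite (le_trans (h i)). Qed.

Lemma cube_dist1 (x y : phase) B : cube B x -> cube (B + dist1 y x) y.
Proof.
move=> h i; rewrite -[coord i y](subrK (coord i x)) (le_trans (ler_normD _ _))//.
by rewrite addrC lerD// ler_coord_dist1.
Qed.

Lemma in_some_cube (x : phase) : exists2 B, 0 <= B & cube B x.
Proof.
exists (\sum_i `|coord i x|); first exact: sumr_ge0.
by move=> i; rewrite (bigD1 i)//= lerDl sumr_ge0.
Qed.

Definition lipschitz (L : R) (f : phase -> R) :=
  forall x y, `|f x - f y| <= L * dist1 x y.

(** Letting the constant depend on the cube makes the class closed under products, so it contains
    all polynomials; it is also enough for measurability and for continuity along coordinate
    lines. *)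
Definition lip_on_cubes (f : phase -> R) := forall B, exists2 L, 0 <= L &
  forall x y, cube B x -> cube B y -> `|f x - f y| <= L * dist1 x y.

Lemma lipschitz_on_cubes L f : 0 <= L -> lipschitz L f -> lip_on_cubes f.
Proof. by move=> L0 h B; exists L. Qed.

Lemma lip_on_cubes_bounded f B : lip_on_cubes f ->
  exists2 M, 0 <= M & forall x, cube B x -> `|f x| <= M.
Proof.
move=> /(_ B)[L L0 fL]; have [B0|B0] := leP 0 B; last first.
  (* For negative [B] the cube is empty as soon as there is one coordinate; without coordinates the
     phase space is a single point. *)
  have [|i] := pselect (exists i : 'I_n + 'I_n, True).
    move=> [i _]; exists 0 => // x /(_ i) xB.
    by have := le_trans xB (ltW B0); rewrite normr_le0 => /eqP xi;
      move: xB; rewrite xi normr0 leNgt B0.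
  exists `|f (mkpt (fun=> 0))| => // x _.
  by rewrite (_ : x = mkpt (fun=> 0))//; apply: eq_phase => j; exfalso; apply: i; exists j.
have c0 : cube B (mkpt (fun=> 0)) by move=> i; rewrite coord_mkpt normr0.
exists (`|f (mkpt (fun=> 0))| + L * \sum_(i : 'I_n + 'I_n) B).
  by rewrite addr_ge0// mulr_ge0// sumr_ge0.
move=> x xB; rewrite -[f x](subrK (f (mkpt (fun=> 0)))) addrC.
rewrite (le_trans (ler_normD _ _))// lerD2l (le_trans (fL _ _ xB c0))//.
rewrite ler_wpM2l//; apply: ler_sum => i _; rewrite coord_mkpt subr0; exact: xB.
Qed.

Lemma lip_on_cubes_cst c : lip_on_cubes (fun=> c).
Proof. by move=> B; exists 0 => // x y _ _; rewrite subrr normr0 mul0r. Qed.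

Lemma lip_on_cubes_coord i : lip_on_cubes (coord i).
Proof. by move=> B; exists 1 => // x y _ _; rewrite mul1r ler_coord_dist1. Qed.

Lemma lip_on_cubesD f g : lip_on_cubes f -> lip_on_cubes g ->
  lip_on_cubes (fun x => f x + g x).
Proof.
move=> hf hg B; have [L L0 fL] := hf B; have [K K0 gK] := hg B.
exists (L + K) => [|x y xB yB]; first exact: addr_ge0.
rewrite opprD addrACA mulrDl (le_trans (ler_normD _ _))// lerD//; [exact: fL|exact: gK].
Qed.

Lemma lip_on_cubesM f g : lip_on_cubes f -> lip_on_cubes g ->
  lip_on_cubes (fun x => f x * g x).
Proof.
move=> hf hg B; have [L L0 fL] := hf B; have [K K0 gK] := hg B.
have [M M0 fM] := lip_on_cubes_bounded B hf.
have [P P0 gP] := lip_on_cubes_bounded B hg.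
exists (L * P + M * K) => [|x y xB yB]; first by rewrite addr_ge0// mulr_ge0.
have -> : f x * g x - f y * g y = (f x - f y) * g x + f y * (g x - g y) by ring.
rewrite [leRHS]mulrDl (le_trans (ler_normD _ _))// !normrM lerD//.
  by rewrite mulrAC ler_pM// ?fL ?gP.
by rewrite -mulrA ler_pM// ?fM ?gK.
Qed.

Lemma lip_on_cubes_slice f x i : lip_on_cubes f -> continuous (fun y => f (upd x i y)).
Proof.
move=> hf y0; have [C C0 xC] := in_some_cube x.
have [L L0 fL] := hf (C + `|y0| + 1).
have cubeu y : `|y - y0| <= 1 -> cube (C + `|y0| + 1) (upd x i y).
  move=> yy0 j; rewrite coord_upd; case: eqP => [_|_].
    have := ler_normD (y - y0) y0; rewrite subrK; lra.
  by have := xC j; have := normr_ge0 y0; lra.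
apply/(@cvgrPdist_le _ _ _ (nbhs y0)) => e e0; near=> y.
have h : `|y0 - y| <= 1 /\ `|y0 - y| <= e / (L + 1).
  by split; near: y; apply: cvgr_dist_le => //; rewrite divr_gt0//; lra.
case: h => h1 h2; rewrite (le_trans (fL _ _ _ _))//.
- by apply: cubeu; rewrite subrr normr0.
- by apply: cubeu; rewrite distrC.
rewrite dist1_upd (@le_trans _ _ ((L + 1) * `|y0 - y|))//.
  by rewrite ler_wpM2r//; lra.
by rewrite mulrC -ler_pdivlMr//; lra.
Unshelve. all: end_near. Qed.
End phase_space.
(** * Lebesgue measure on the phase space *)

Section bounded_integrable.
Context d (T : measurableType d) (R : realType).
Variable mu : {measure set T -> \bar R}.

Lemma integrable_bounded_supp (D : set T) (f : T -> R) (M : R) :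
  measurable D -> (mu D < +oo)%E -> measurable_fun setT f ->
  (forall x, `|f x| <= M) -> (forall x, ~ D x -> f x = 0) ->
  mu.-integrable setT (EFin \o f).
Proof.
move=> mD Dfin mf fM fD.
have -> : EFin \o f = (EFin \o f) \_ D.
  apply/funext => x; rewrite patchE; case: ifPn => // /negP xD.
  by rewrite /= fD// => Dx; apply: xD; rewrite inE.
apply/(integrable_mkcond _ mD); apply: measurable_bounded_integrable => //.
  exact: measurable_funTS.
by exists M; split; [exact: num_real|move=> r Mr x _ /=; rewrite (le_trans (fM x))// ltW].
Qed.
End bounded_integrable.

(** * Fubini along a single coordinate of a tuple *)

Section tuple_slices.
Context (R : realType).
Local Notation leb := (@lebesgue_measure R).
Local Notation T := (measurableTypeR R).

Definition tuple_upd n (t : n.-tuple T) (i : 'I_n) (y : T) : n.-tuple T :=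
  [tuple if j == i then y else tnth t j | j < n].

Definition tuple_cube n (B : R) : set (n.-tuple T) :=
  [set t | forall i, tnth t i \in `[- B, B]].

Lemma measurable_tuple_box n (A : 'I_n -> set T) : (forall i, measurable (A i)) ->
  measurable [set t : n.-tuple T | forall i, A i (tnth t i)].
Proof.
move=> mA; have -> : [set t : n.-tuple T | forall i, A i (tnth t i)] =
    \bigcap_(i in [set: 'I_n]) ((@tnth _ T ^~ i) @^-1` A i).
  by apply/seteqP; split=> t /=; [move=> h i _; exact: h|move=> h i; exact: h].
apply: fin_bigcap_measurable; first exact: finite_finset.
by move=> i _; rewrite -[X in measurable X]setTI; exact: measurable_tnth.
Qed.

Lemma measurable_tuple_cube n B : measurable (@tuple_cube n B).
Proof.
by apply: (@measurable_tuple_box _ (fun=> `[- B, B]%classic)) => i; exact: measurable_itv.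
Qed.

Lemma lebesgue_segment_fin_num (a b : R) : leb `[a, b]%classic \is a fin_num.
Proof. by rewrite lebesgue_measure_itv/=; case: ifP. Qed.

Lemma tuple_measure_cube_lty n B : (tuple_measure leb n (@tuple_cube n B) < +oo)%E.
Proof.
have -> : tuple_measure leb n (@tuple_cube n B) = (\prod_(i < n) leb `[(- B)%R, B]%classic)%E.
  apply: (tuple_measure_box leb (A := fun _ : 'I_n => (`[- B, B]%classic : set R))) => i.
  exact: measurable_itv.
have -> : leb `[- B, B]%classic = (fine (leb `[- B, B]%classic))%:E.
  by rewrite fineK//; exact: lebesgue_segment_fin_num.
rewrite (eq_bigr (fun=> (fine (leb `[- B, B]%classic))%:E))//.
by rewrite prodEFin ltry.
Qed.

(** Induction along the recursive definition of [tuple_measure]. If [i] is the head, the head is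
    integrated innermost; otherwise the head is frozen and the induction hypothesis treats the tail.
    The bound and the cube pass to slices and give the integrability that Fubini requires. Asking
    only for vanishing avoids any identification of the remaining $n-1$ coordinates. *)
Lemma tuple_integral_slice n (f : n.-tuple T -> R) B M (i : 'I_n) :
  measurable_fun setT f -> (forall t, `|f t| <= M) ->
  (forall t, ~ tuple_cube B t -> f t = 0) ->
  (forall t, \int[leb]_y (f (tuple_upd t i y))%:E = 0)%E ->
  (\int[tuple_measure leb n]_t (f t)%:E = 0)%E.
Proof.
elim: n f i => [f []//|n IHn f i mf fM fB f0].
have mfc : measurable_fun setT (f \o @tcons _ T n).
  by apply: measurableT_comp => //; exact: measurable_tcons.
have intf : (leb \x tuple_measure leb n)%E.-integrable setT (EFin \o (f \o @tcons _ T n)).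
  have := @integrable_bounded_supp _ _ _ (leb \x tuple_measure leb n)%E
    (`[- B, B] `*` @tuple_cube n B) (f \o @tcons _ T n) M.
  apply => //.
  - by apply: measurableX; [exact: measurable_itv|exact: measurable_tuple_cube].
  - rewrite /= product_measure1E//; last exact: measurable_tuple_cube.
    rewrite lte_mul_pinfty//; last exact: tuple_measure_cube_lty.
    exact: lebesgue_segment_fin_num.
  - by move=> x; exact: fM.
  - move=> [x t] /= h; apply: fB => c; apply: h; split.
      by have := c ord0; rewrite tnth0.
    by move=> j; have := c (lift ord0 j); rewrite tnthS.
have mfE : measurable_fun setT (EFin \o f) by exact/measurable_EFinP.
rewrite /= (integral_pushforward (@measurable_tcons _ _ n) mfE) ?preimage_setT//.
case: (unliftP ord0 i) f0 => [j ->|->] f0.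
  rewrite -integral12_prod_meas1//; apply: integral0_eq => x _.
  rewrite /fubini_F /=; apply: (IHn (fun t => f (tcons (x, t))) j).
  - exact: (measurable_fun_pair2 x mfc).
  - by move=> t; exact: fM.
  - move=> t h; apply: fB => c; apply: h => k.
    by have := c (lift ord0 k); rewrite tnthS.
  - move=> t; rewrite -[RHS](f0 (tcons (x, t))); apply: eq_integral => y _.
    congr (f _)%:E; apply: eq_from_tnth => k; rewrite tnth_mktuple.
    have [l ->|->] := unliftP ord0 k; last by rewrite !tnth0.
    by rewrite !tnthS tnth_mktuple (inj_eq lift_inj).
rewrite -integral21_prod_meas1//; apply: integral0_eq => t _.
rewrite /fubini_G /= -[RHS](f0 (@tcons _ T n ((0 : R), t))); apply: eq_integral => y _.
congr (f _)%:E; apply: eq_from_tnth => k; rewrite tnth_mktuple.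
by have [l ->|->] := unliftP ord0 k; rewrite ?tnth0 ?tnthS.
Qed.
End tuple_slices.

Section phase_integral.
Context (R : realType) (n : nat).
Local Notation leb := (@lebesgue_measure R).
Local Notation E := (phase R n).

Lemma measurable_coord i : measurable_fun setT (@coord R n i).
Proof.
case: i => k /=.
  exact: (measurableT_comp (measurable_tnth k) measurable_fst).
exact: (measurableT_comp (measurable_tnth k) measurable_snd).
Qed.

Lemma measurable_to_phase d (T : measurableType d) (f : T -> E) :
  (forall i, measurable_fun setT (coord i \o f)) -> measurable_fun setT f.
Proof.
move=> mf; apply/measurable_fun_pairP; split; apply/measurable_fun_tnthP => k.
- exact: (mf (inl k)).
- exact: (mf (inr k)).
Qed.

Definition phase_box (a b : 'I_n + 'I_n -> R) : set E :=
  [set x | forall i, a i < coord i x < b i].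

Lemma measurable_phase_box a b : measurable (phase_box a b).
Proof.
have -> : phase_box a b =
    \bigcap_(i in [set: 'I_n + 'I_n]) (coord i @^-1` `]a i, b i[).
  apply/seteqP; split=> t /=; first by move=> h i _ /=; rewrite in_itv; exact: h.
  by move=> h i; have := h i I; rewrite /= in_itv.
apply: fin_bigcap_measurable; first exact: finite_finset.
move=> i _; rewrite -[X in measurable X]setTI; apply: measurable_coord => //.
Qed.

(** The sigma-algebra on tuples is generated by coordinates, not given as a Borel one. Hence each
    superlevel set is written as the union of the boxes with rational corners that it contains, a
    countable family. *)
Lemma measurable_lip_on_cubes (f : E -> R) : lip_on_cubes f -> measurable_fun setT f.
Proof.
move=> hf; apply: (measurability _ (RGenOInfty.measurableE R)).
move=> _ [_ [a ->] <-]; rewrite setTI.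
pose bx (q : {ffun 'I_n + 'I_n -> rat} * {ffun 'I_n + 'I_n -> rat}) :=
  phase_box (fun i => ratr (q.1 i)) (fun i => ratr (q.2 i)).
have -> : f @^-1` `]a, +oo[ = \bigcup_(q in [set: _])
    (if pselect (bx q `<=` f @^-1` `]a, +oo[) then bx q else set0).
  apply/seteqP; split=> [x /=|x [q _]]; last by case: pselect => // h /h.
  rewrite in_itv/= andbT => afx.
  have [B B0 xB] := in_some_cube x; have [L L0 fL] := hf (B + 1).
  pose c : R := #|{: 'I_n + 'I_n}|%:R.
  have c0 : 0 <= c by [].
  (* A point whose [c] coordinates are each within [e] of those of [x] changes [f] by at most
     [L * c * e]. The bound [e <= 1] keeps it in the cube where [L] is valid, and the [+ 1] covers
     [L * c = 0]. *)
  pose e := Num.min 1 ((f x - a) / (L * c + 1)).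
  have Lc0 : 0 < L * c + 1 by have := mulr_ge0 L0 c0; lra.
  have e0 : 0 < e by rewrite lt_min ltr01 divr_gt0// subr_gt0.
  have e1 : e <= 1 by rewrite ge_min lexx.
  have Le : L * c * e < f x - a.
    have : (L * c + 1) * e <= f x - a.
      by rewrite mulrC -ler_pdivlMr// ge_min lexx orbT.
    lra.
  have /choice[p hp] : forall i, exists p : rat, coord i x - e < ratr p < coord i x.
    move=> i; have : coord i x - e < coord i x by lra.
    by move=> /rat_in_itvoo[p]; rewrite in_itv/= => h; exists p.
  have /choice[q hq] : forall i, exists p : rat, coord i x < ratr p < coord i x + e.
    move=> i; have : coord i x < coord i x + e by lra.
    by move=> /rat_in_itvoo[r]; rewrite in_itv/= => h; exists r.
  exists ([ffun i => p i], [ffun i => q i]) => //.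
  case: pselect => [_ i|]; first by rewrite !ffunE; have := hp i; have := hq i; lra.
  case=> y yb /=; rewrite in_itv/= andbT.
  have xy i : `|coord i y - coord i x| <= e.
    have := yb i; rewrite !ffunE; have := hp i; have := hq i.
    by rewrite ler_norml; lra.
  have yB : cube (B + 1) y.
    move=> i; have := ler_normD (coord i y - coord i x) (coord i x).
    by rewrite subrK; have := xB i; have := xy i; lra.
  have xB1 : cube (B + 1) x by apply: cube_mono xB; lra.
  have : `|f y - f x| <= L * c * e.
    rewrite (le_trans (fL _ _ yB xB1))// -mulrA ler_wpM2l//.
    by rewrite mulrC /c mulr_natr -sumr_const ler_sum.
  by rewrite ler_norml; lra.
apply: countable_bigcupT_measurable => [|q]; first exact: countableP.
by case: pselect => h /=; [exact: measurable_phase_box|exact: measurable0].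
Qed.

Definition phase_measure := (tuple_measure leb n \x tuple_measure leb n)%E.

Lemma cubeE B : @cube R n B = @tuple_cube R n B `*` @tuple_cube R n B.
Proof.
apply/seteqP; split=> [x xB|x [h1 h2] [k|k]] /=; last 2 first.
- by have := h1 k; rewrite /= in_itv/= ler_norml.
- by have := h2 k; rewrite /= in_itv/= ler_norml.
split=> k /=; rewrite in_itv/= -ler_norml.
- exact: (xB (inl k)).
- exact: (xB (inr k)).
Qed.

Lemma measurable_cube B : measurable (@cube R n B).
Proof. by rewrite cubeE; apply: measurableX; exact: measurable_tuple_cube. Qed.

Lemma phase_measure_cube_lty B : (phase_measure (cube B) < +oo)%E.
Proof.
rewrite cubeE /phase_measure product_measure1E; try exact: measurable_tuple_cube.
by rewrite lte_mul_pinfty// ?ge0_fin_numE//; exact: tuple_measure_cube_lty.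
Qed.

(** Such functions are bounded and vanish off a set of finite measure, which makes [pint] additive
    and homogeneous on them. *)
Definition test_fun B (f : E -> R) :=
  lip_on_cubes f /\ forall x, ~ cube B x -> f x = 0.

Lemma test_fun_bounded B f : test_fun B f -> exists2 M, 0 <= M & forall x, `|f x| <= M.
Proof.
move=> [lf fB]; have [M M0 h] := lip_on_cubes_bounded B lf; exists M => // x.
by have [/h//|/fB ->] := pselect (cube B x); rewrite normr0.
Qed.

Lemma test_fun_integrable B f : test_fun B f ->
  phase_measure.-integrable setT (EFin \o f).
Proof.
move=> tf; have [M _ fM] := test_fun_bounded tf; have [lf fB] := tf.
apply: (@integrable_bounded_supp _ _ _ _ (cube B) _ M) => //.
- exact: measurable_cube.
- exact: phase_measure_cube_lty.
- exact: measurable_lip_on_cubes.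
Qed.

Definition pint (f : E -> R) : R := (\int[phase_measure]_x f x)%R.

Lemma test_funD B f g : test_fun B f -> test_fun B g ->
  test_fun B (fun x => f x + g x).
Proof.
move=> [lf f0] [lg g0]; split; first exact: lip_on_cubesD.
by move=> x xB; rewrite f0// g0// addr0.
Qed.

Lemma test_funM B f g : test_fun B f -> lip_on_cubes g ->
  test_fun B (fun x => g x * f x).
Proof.
move=> [lf f0] lg; split; first exact: lip_on_cubesM.
by move=> x xB; rewrite f0// mulr0.
Qed.

Lemma test_funZ B f c : test_fun B f -> test_fun B (fun x => c * f x).
Proof. by move=> tf; apply: test_funM => //; exact: lip_on_cubes_cst. Qed.

Lemma pintD B f g : test_fun B f -> test_fun B g ->
  pint (fun x => f x + g x) = pint f + pint g.
Proof.
by move=> tf tg; apply: RintegralD => //;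
  [exact: (test_fun_integrable tf)|exact: (test_fun_integrable tg)].
Qed.

Lemma pintZ B f c : test_fun B f -> pint (fun x => c * f x) = c * pint f.
Proof. by move=> tf; apply: RintegralZl => //; exact: (test_fun_integrable tf). Qed.

Lemma pintB B f g : test_fun B f -> test_fun B g ->
  pint (fun x => f x - g x) = pint f - pint g.
Proof.
by move=> tf tg; apply: RintegralB => //;
  [exact: (test_fun_integrable tf)|exact: (test_fun_integrable tg)].
Qed.

Lemma le_pint B f (e : R) : test_fun B f -> (forall x, cube B x -> `|f x| <= e) ->
  `|pint f| <= e * fine (phase_measure (cube B)).
Proof.
move=> tf fe; have [lf f0] := tf.
have mC := measurable_cube B.
have -> : pint f = (\int[phase_measure]_(x in cube B) f x)%R.
  rewrite [RHS]Rintegral_mkcond; apply: eq_Rintegral => x _.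
  rewrite patchE; case: ifPn => // /negP xB.
  by rewrite f0// => h; apply: xB; rewrite inE.
have intf : phase_measure.-integrable (cube B) (EFin \o f).
  by apply: (integrableS _ _ _ (test_fun_integrable tf)).
rewrite (le_trans (le_normr_Rintegral _ _))//.
rewrite -Rintegral_cst//; apply: le_Rintegral => //.
- exact: integrable_norm.
- apply: (measurable_bounded_integrable _ _ _ _) => //.
  + exact: phase_measure_cube_lty.
  + by exists `|e|; split; [exact: num_real|move=> r er x _ /=; rewrite ltW].
Qed.

Lemma pint_slice B f i : test_fun B f ->
  (forall x, \int[leb]_y (f (upd x i y))%:E = 0)%E -> pint f = 0.
Proof.
move=> tf f0; have [M _ fM] := test_fun_bounded tf; have [lf fB] := tf.
have intf := test_fun_integrable tf; have mf := measurable_lip_on_cubes lf.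
rewrite /pint /Rintegral; apply/eqP; rewrite fine_eq0; last first.
  exact: integrable_fin_num.
apply/eqP; move: intf; rewrite /phase_measure => intf.
case: i f0 => k f0.
  rewrite -integral21_prod_meas1//; apply: integral0_eq => t _.
  apply: (@tuple_integral_slice _ _ (fun s => f (s, t)) B M k).
  - exact: measurable_fun_pair1.
  - by move=> s; exact: fM.
  - by move=> s h; apply: fB; rewrite cubeE => -[].
  - move=> s; rewrite -[RHS](f0 (s, t)); apply: eq_integral => y _.
    congr (f _)%:E; apply: eq_phase => -[j|j]; rewrite coord_upd /=.
      by rewrite tnth_mktuple (inj_eq inl_inj).
    by [].
rewrite -integral12_prod_meas1//; apply: integral0_eq => t _.
apply: (@tuple_integral_slice _ _ (fun s => f (t, s)) B M k).
- exact: measurable_fun_pair2.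
- by move=> s; exact: fM.
- by move=> s h; apply: fB; rewrite cubeE => -[].
- move=> s; rewrite -[RHS](f0 (t, s)); apply: eq_integral => y _.
  congr (f _)%:E; apply: eq_phase => -[j|j]; rewrite coord_upd /=.
    by [].
  by rewrite tnth_mktuple (inj_eq inr_inj).
Qed.
End phase_integral.
(** * One-coordinate shears *)

Section one_dimensional.
Context (R : realType).
Local Notation leb := (@lebesgue_measure R).

Lemma is_derive_continuous (f : R -> R) (df x : R) : is_derive x 1 f df ->
  {for x, continuous f}.
Proof. by move=> [h _]; apply/differentiable_continuous/derivable1_diffP. Qed.

Lemma FTC2_is_derive (F f : R -> R) (a b : R) : a < b ->
  (forall x, a <= x <= b -> is_derive x 1 F (f x)) ->
  (forall x, a <= x <= b -> {for x, continuous f}) ->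
  (\int[leb]_(x in `[a, b]) (f x)%:E = (F b - F a)%:E)%E.
Proof.
move=> ab dF cf; have cF x : a <= x <= b -> {for x, continuous F}.
  by move=> /dF; exact: is_derive_continuous.
rewrite (continuous_FTC2 ab (F := F))//.
- apply: continuous_in_subspaceT => x; rewrite inE/= in_itv/= => xab; exact: cf.
- split=> [x||].
  + by rewrite in_itv/= => /andP[ax xb]; have [] : is_derive x 1 F (f x) by apply: dF; rewrite !ltW.
  + by apply: cvg_at_right_filter; apply: cF; rewrite lexx ltW.
  + by apply: cvg_at_left_filter; apply: cF; rewrite lexx ltW.
- move=> x; rewrite in_itv/= => /andP[ax xb]; rewrite derive1E.
  by have := dF x; rewrite !ltW// => /(_ isT) h; exact: derive_val.
Qed.

(* Substitution without monotonicity: if [chi] vanishes outside [-B0, B0], a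
   primitive of [chi] composed with [y + h y] takes the same values at the
   endpoints [-B] and [B] as the primitive itself. *)
Lemma integral_near_identity (chi h dh : R -> R) (B0 B : R) :
  0 <= B0 -> B0 < B -> continuous chi ->
  (forall y, B0 < `|y| -> chi y = 0) ->
  (forall y : R, is_derive y 1 h (dh y)) -> continuous dh ->
  (forall y, `|y| <= B -> `|h y| <= B - B0) ->
  (\int[leb]_(y in `[(- B)%R, B]) (chi (y + h y) * (1 + dh y))%R%:E =
   \int[leb]_(y in `[(- B)%R, B]) (chi y)%:E)%E.
Proof.
move=> B00 B0B cchi chi0 dh_ cdh hB.
(* Every [y + h y] with [|y| <= B] is at least [- 2 * B]; the extra 1 makes all these points
   interior, where the primitive from [P] is differentiable. *)
pose P : R := - (2 * B + 1).
pose Psi z : R := (\int[leb]_(t in `[P, z]) chi t)%R.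
have dPsi z : P < z -> is_derive z 1 Psi (chi z).
  move=> Pz; have zz : z < z + 1 by rewrite ltrDl.
  have intchi : leb.-integrable `[P, z + 1] (EFin \o chi).
    apply: continuous_compact_integrable; first exact: segment_compact.
    by apply: continuous_subspaceT => x; exact: cchi.
  have [dP P'] := continuous_FTC1_closed zz intchi Pz (cchi z).
  by split; [exact: dP|rewrite -derive1E; exact: P'].
have Psi_cst a b : P < a -> a <= b -> (forall c, a < c < b -> chi c = 0) -> Psi a = Psi b.
  move=> Pa; rewrite le_eqVlt => /predU1P[->//|ab] chi_ab.
  have [c||c] := @MVT _ Psi chi a b ab.
  - by rewrite in_itv/= => /andP[ac _]; apply: dPsi; exact: lt_trans ac.
  - apply: continuous_in_subspaceT => x; rewrite inE/= in_itv/= => /andP[ax _].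
    exact: is_derive_continuous (dPsi _ (lt_le_trans Pa ax)).
  by rewrite in_itv/= => /chi_ab -> /eqP; rewrite mul0r subr_eq0 => /eqP.
have hlt y : - B <= y <= B -> - (B - B0) <= h y <= B - B0.
  by rewrite -ler_norml -ler_norml; exact: hB.
have BB : - B < B by lra.
have Pg y : - B <= y <= B -> P < y + h y by move=> yB; have := hlt _ yB; rewrite /P; lra.
have e1 : (\int[leb]_(y in `[(- B)%R, B]) (chi (y + h y) * (1 + dh y))%R%:E =
    (Psi (B + h B) - Psi (- B + h (- B)))%:E)%E.
  apply: (@FTC2_is_derive (fun y => Psi (y + h y))) => // [y yB|y _].
    have h1 := dPsi _ (Pg _ yB); have h2 := dh_ y.
    by apply: is_derive1_comp.
  have c1 : (1 + dh z) @[z --> y] --> 1 + dh y by apply: cvgD; [exact: cvg_cst|exact: cdh].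
  have c2 : chi (z + h z) @[z --> y] --> chi (y + h y).
    apply: (@continuous_comp _ _ _ (fun y => y + h y) chi); last exact: cchi.
    by apply: cvgD; [exact: cvg_id|exact: is_derive_continuous (dh_ y)].
 exact: (cvgM c2 c1).
have e2 : (\int[leb]_(y in `[(- B)%R, B]) (chi y)%:E = (Psi B - Psi (- B))%:E)%E.
  apply: FTC2_is_derive => // [y yB|y _]; last exact: cchi.
  by apply: dPsi; rewrite /P; lra.
rewrite e1 e2.
have h1 := hlt B; have h2 := hlt (- B).
have {}h1 : - (B - B0) <= h B <= B - B0 by apply: h1; lra.
have {}h2 : - (B - B0) <= h (- B) <= B - B0 by apply: h2; lra.
(* Since [h] moves the endpoints by at most [B - B0], the images of [B] and [- B] stay beyond [B0]
   and [- B0], where the primitive is constant. *)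
have right_cst a : B0 <= a -> Psi a = Psi B0.
  move=> B0a; apply/esym/Psi_cst => //; first by rewrite /P; lra.
  by move=> c /andP[B0c _]; apply: chi0; rewrite (lt_le_trans B0c)// ler_norm.
have left_cst a : P < a -> a <= - B0 -> Psi a = Psi (- B0).
  move=> Pa aB0; apply: Psi_cst => // c /andP[_ cB0]; apply: chi0.
  by rewrite -normrN (@lt_le_trans _ _ (- c))// ?ler_norm//; lra.
rewrite (right_cst (B + h B)) ?(right_cst B) ?(left_cst (- B)) ?(left_cst (- B + h (- B)))//;
  by rewrite ?/P; lra.
Qed.
End one_dimensional.

(** * Polynomials in the coordinates, as syntax *)

Section polynomial.
Context (R : realType) (n : nat).
Local Notation E := (phase R n).

Inductive rpoly := RConst of R | RVar of 'I_n + 'I_n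
  | RAdd of rpoly & rpoly | RMul of rpoly & rpoly.

Fixpoint peval (p : rpoly) (x : E) : R := match p with
  | RConst c => c
  | RVar i => coord i x
  | RAdd p q => peval p x + peval q x
  | RMul p q => peval p x * peval q x
  end.

Fixpoint pder (i : 'I_n + 'I_n) (p : rpoly) : rpoly := match p with
  | RConst c => RConst 0
  | RVar j => RConst (j == i)%:R
  | RAdd p q => RAdd (pder i p) (pder i q)
  | RMul p q => RAdd (RMul (pder i p) q) (RMul p (pder i q))
  end.

Lemma lip_on_cubes_peval p : lip_on_cubes (peval p).
Proof.
elim: p => [c|i|p hp q hq|p hp q hq] /=.
- exact: lip_on_cubes_cst.
- exact: lip_on_cubes_coord.
- exact: lip_on_cubesD.
- exact: lip_on_cubesM.
Qed.

Lemma is_derive_peval p x i (y : R) :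
  is_derive y 1 (fun z => peval p (upd x i z)) (peval (pder i p) (upd x i y)).
Proof.
elim: p => [c|j|p hp q hq|p hp q hq] /=.
- exact: is_derive_cst.
- rewrite (_ : (fun z => _) = (fun z => if j == i then z else coord j x)); last first.
    by apply/funext => z; rewrite coord_upd.
  by case: eqP => _; [exact: is_derive_id|exact: is_derive_cst].
- exact: is_deriveD.
- apply: (is_derive_eq (is_deriveM hp hq)).
  by rewrite /GRing.scale/= addrC mulrC [X in X + _]mulrC addrC; ring.
Qed.
End polynomial.
Section uniform_bounds.
Context (R : realType) (n : nat).
Local Notation E := (phase R n).
Local Notation I := ('I_n + 'I_n)%type.

Lemma lip_on_cubes_uniform (f : I -> E -> R) B : (forall i, lip_on_cubes (f i)) ->
  exists M K, [/\ 0 <= M, 0 <= K,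
    forall i x, cube B x -> `|f i x| <= M &
    forall i x y, cube B x -> cube B y -> `|f i x - f i y| <= K * dist1 x y].
Proof.
move=> hf.
have /choice[M hM] : forall i, exists M, 0 <= M /\ forall x, cube B x -> `|f i x| <= M.
  by move=> i; have [M M0 h] := lip_on_cubes_bounded B (hf i); exists M.
have /choice[K hK] : forall i, exists K, 0 <= K /\
    forall x y, cube B x -> cube B y -> `|f i x - f i y| <= K * dist1 x y.
  by move=> i; have [K K0 h] := hf i B; exists K.
exists (\sum_i M i), (\sum_i K i); split.
- by apply: sumr_ge0 => i _; have [] := hM i.
- by apply: sumr_ge0 => i _; have [] := hK i.
- move=> i x xB; rewrite (bigD1 i)//= (le_trans ((hM i).2 _ xB))// lerDl.
  by apply: sumr_ge0 => j _; have [] := hM j.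
- move=> i x y xB yB; rewrite (le_trans ((hK i).2 _ _ xB yB))// ler_wpM2r ?dist1_ge0//.
  by rewrite (bigD1 i)//= lerDl; apply: sumr_ge0 => j _; have [] := hK j.
Qed.
End uniform_bounds.

Section clamp.
Context (R : realType) (n : nat).
Local Notation E := (phase R n).

Definition clampr (B z : R) : R := Num.max (- B) (Num.min B z).

Lemma clampr_le B z : 0 <= B -> `|clampr B z| <= B.
Proof.
move=> B0; rewrite /clampr ler_norml le_max lexx/= ge_max ge_min lexx/=.
by rewrite andbT; lra.
Qed.

Lemma clampr_id B z : `|z| <= B -> clampr B z = z.
Proof.
by rewrite ler_norml => /andP[Bz zB]; rewrite /clampr (min_r zB) (max_r Bz).
Qed.

Lemma clampr_lip B y z : `|clampr B y - clampr B z| <= `|y - z|.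
Proof.
rewrite /clampr /Num.max /Num.min.
by repeat case: ifPn; rewrite -?leNgt => *; rewrite ler_norml;
  have := ler_norm (y - z); have := ler_norm (z - y); rewrite distrC => *; lra.
Qed.

(** A 1-Lipschitz projection onto [cube B]: composing with it turns bounds valid on the cube into
    global ones. *)
Definition clamp (B : R) (x : E) : E := mkpt (fun i => clampr B (coord i x)).

Lemma cube_clamp B x : 0 <= B -> cube B (clamp B x).
Proof. by move=> B0 i; rewrite coord_mkpt clampr_le. Qed.

Lemma clamp_id B x : cube B x -> clamp B x = x.
Proof. by move=> xB; apply: eq_phase => i; rewrite coord_mkpt clampr_id. Qed.

Lemma clamp_lip B x y : dist1 (clamp B x) (clamp B y) <= dist1 x y.
Proof. by apply: ler_sum => i _; rewrite !coord_mkpt clampr_lip. Qed.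
End clamp.

(** * Change of the integral under compositions of shears *)

Section splitting.
Context (R : realType) (n : nat).
Local Notation E := (phase R n).
Local Notation I := ('I_n + 'I_n)%type.
Local Notation leb := (@lebesgue_measure R).
Variables (X : I -> rpoly R n) (B MX KX MD : R).
Hypothesis B_ge0 : 0 <= B.
Hypotheses (MX_ge0 : 0 <= MX) (KX_ge0 : 0 <= KX) (MD_ge0 : 0 <= MD).
Hypothesis X_bound : forall i x, cube B x -> `|peval (X i) x| <= MX.
Hypothesis X_lip : forall i x y, cube B x -> cube B y ->
  `|peval (X i) x - peval (X i) y| <= KX * dist1 x y.
Hypothesis D_bound : forall i x, cube B x -> `|peval (pder i (X i)) x| <= MD.

Definition field i x := peval (X i) (clamp B x).

Lemma field_bound i x : `|field i x| <= MX.
Proof. by apply: X_bound; exact: cube_clamp. Qed.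

Lemma field_lip i x y : `|field i x - field i y| <= KX * dist1 x y.
Proof.
rewrite (le_trans (X_lip _ _ _))//; try exact: cube_clamp.
by rewrite ler_wpM2l// clamp_lip.
Qed.

Definition shear s i (x : E) : E := upd x i (coord i x + s * field i x).

Lemma dist1_shear s i x : dist1 (shear s i x) x <= `|s| * MX.
Proof.
by rewrite dist1_updl addrC addKr normrM ler_wpM2l// field_bound.
Qed.

Lemma shear_lip s i x y :
  dist1 (shear s i x) (shear s i y) <= (1 + `|s| * KX) * dist1 x y.
Proof.
rewrite mulrDl mul1r {1 2}/dist1 (bigD1 i)//= [in leRHS](bigD1 i)//=.
rewrite -addrA [X in _ <= _ + X]addrC addrA; apply: lerD; last first.
  by apply: ler_sum => j /negbTE ji; rewrite !coord_upd ji.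
rewrite !coord_upd eqxx opprD addrACA -mulrBr (le_trans (ler_normD _ _))// lerD2l.
by rewrite normrM -mulrA ler_wpM2l// field_lip.
Qed.

Lemma lipschitz_shear L psi s i : 0 <= L -> `|s| * KX <= 1 -> lipschitz L psi ->
  lipschitz (2 * L) (psi \o shear s i).
Proof.
move=> L0 sK psiL x y; rewrite (le_trans (psiL _ _))// mulrC -mulrA mulrCA.
rewrite [X in _ <= X](_ : _ = L * (2 * dist1 x y)); last by ring.
rewrite mulrC ler_wpM2l// (le_trans (shear_lip _ _ _ _))//.
by rewrite ler_wpM2r ?dist1_ge0//; lra.
Qed.

Lemma shear_supp (psi : E -> R) B0 s i :
  (forall x, ~ cube B0 x -> psi x = 0) ->
  forall x, ~ cube (B0 + `|s| * MX) x -> psi (shear s i x) = 0.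
Proof.
move=> psi0 x h; apply: psi0 => c; apply: h.
apply: (cube_mono _ (cube_dist1 x c)); rewrite lerD2l dist1C; exact: dist1_shear.
Qed.

(** The difference of the two sides is the integral of one test function, and [pint_slice] reduces
    its vanishing to lines in direction [i]. There [integral_near_identity] applies with
    displacement [s * peval (X i)]. The room [B - B0] keeps the sheared support inside [cube B],
    where [clamp] is the identity. *)
Lemma pint_shear L psi B0 s i : 0 <= L -> 0 <= B0 -> B0 < B ->
  `|s| * MX <= B - B0 -> `|s| * KX <= 1 ->
  lipschitz L psi -> (forall x, ~ cube B0 x -> psi x = 0) ->
  pint (psi \o shear s i) +
  s * pint (fun x => peval (pder i (X i)) x * psi (shear s i x)) = pint psi.
Proof.
move=> L0 B00 B0B sM sK psiL psi0.
have lpsi : lip_on_cubes psi by exact: lipschitz_on_cubes psiL.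
have t1 : test_fun B psi.
  by split=> // x h; apply: psi0 => c; apply: h; apply: cube_mono c; exact: ltW.
have t2 : test_fun B (psi \o shear s i).
  split; first by apply: (lipschitz_on_cubes _ (lipschitz_shear i L0 sK psiL)); rewrite mulr_ge0.
  move=> x h; apply: (@shear_supp psi B0 s i psi0) => c; apply: h; apply: cube_mono c.
  by rewrite -lerBrDl.
have t3 : test_fun B (fun x => peval (pder i (X i)) x * psi (shear s i x)).
  exact: (test_funM t2 (lip_on_cubes_peval _)).
apply/eqP; rewrite -subr_eq0 -(pintZ s t3) -(pintD t2 (test_funZ s t3)).
rewrite -(pintB (test_funD t2 (test_funZ s t3)) t1); apply/eqP.
have tN : test_fun B (fun x => psi (shear s i x) +
    s * (peval (pder i (X i)) x * psi (shear s i x)) - psi x).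
  have := test_funD (test_funD t2 (test_funZ s t3)) (test_funZ (-1) t1).
  by under eq_fun do rewrite mulN1r.
apply: (pint_slice (i := i) tN) => x.
set F := fun y : R => _.
(* If another coordinate already exceeds [B], the whole line misses the support. Otherwise only the
   segment [[- B, B]] of the line matters, and it lies in the cube. *)
have [xB|] := pselect (forall j, j != i -> `|coord j x| <= B); last first.
  move=> h; have [j [ji jB]] : exists j, j != i /\ B < `|coord j x|.
    apply/not_existsP => h'; apply: h => j ji.
    by rewrite leNgt; apply/negP => ?; exact: (h' j).
  apply: integral0_eq => y _; congr EFin; rewrite /F tN.2// => /(_ j).
  by rewrite coord_upd (negbTE ji) leNgt jB.
have cubeB y : `|y| <= B -> cube B (upd x i y).
  by move=> yB j; rewrite coord_upd; case: eqP => // /eqP; exact: xB.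
have F0 y : ~ (`[- B, B]%classic y) -> F y = 0%E.
  move=> h; rewrite /F; congr EFin; rewrite tN.2// => /(_ i).
  by rewrite coord_upd eqxx => yB; apply: h; rewrite /= in_itv/= -ler_norml.
have -> : (\int[leb]_y F y = \int[leb]_(y in `[(- B)%R, B]) F y)%E.
  rewrite [RHS]integral_mkcond; apply: eq_integral => y _; rewrite patchE.
  by case: ifPn => // /negP yB; rewrite F0// => h; apply: yB; rewrite inE.
pose h y := s * peval (X i) (upd x i y).
pose dh y := s * peval (pder i (X i)) (upd x i y).
pose chi y := psi (upd x i y).
have cchi : continuous chi by exact: lip_on_cubes_slice.
have cdh : continuous dh.
  move=> y; apply: cvgM; first exact: cvg_cst.
  exact: (lip_on_cubes_slice (lip_on_cubes_peval _)).
have ch : continuous h.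
  move=> y; apply: cvgM; first exact: cvg_cst.
  exact: (lip_on_cubes_slice (lip_on_cubes_peval _)).
have -> : (\int[leb]_(y in `[(- B)%R, B]) F y =
    \int[leb]_(y in `[(- B)%R, B]) (chi (y + h y) * (1 + dh y) - chi y)%R%:E)%E.
  apply: eq_integral => y; rewrite inE/= in_itv/= -ler_norml => yB; congr EFin.
  have -> : shear s i (upd x i y) = upd x i (y + h y).
    by rewrite /shear upd_upd coord_upd eqxx /field clamp_id//; exact: cubeB.
  by rewrite -/(chi _) -/(chi _) /dh; ring.
have intc (g : R -> R) : continuous g -> leb.-integrable `[- B, B] (EFin \o g).
  move=> cg; apply: continuous_compact_integrable; first exact: segment_compact.
  exact: continuous_subspaceT.
under eq_integral do rewrite EFinB.
rewrite integralB_EFin//; [|apply: (intc (fun y => _)) => y|exact: intc]; last first.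
  have c1 : (1 + dh z) @[z --> y] --> 1 + dh y by apply: cvgD; [exact: cvg_cst|exact: cdh].
  have c2 : chi (z + h z) @[z --> y] --> chi (y + h y).
    apply: (@continuous_comp _ _ _ (fun y => y + h y) chi); last exact: cchi.
    by apply: cvgD; [exact: cvg_id|exact: ch].
  exact: (cvgM c2 c1).
have -> : (\int[leb]_(y in `[(- B)%R, B]) (chi (y + h y) * (1 + dh y))%R%:E =
   \int[leb]_(y in `[(- B)%R, B]) (chi y)%:E)%E.
  apply: (integral_near_identity B00 B0B cchi _ _ cdh).
  - by move=> y yB; apply: psi0 => /(_ i); rewrite coord_upd eqxx leNgt yB.
  - move=> y; have hd := is_derive_peval (X i) x i y.
    exact: (is_deriveZ s hd).
  - move=> y yB; rewrite /h normrM (le_trans _ sM)// ler_wpM2l// X_bound//.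
    exact: cubeB.
by rewrite subee//; apply: integrable_fin_num => //; exact: intc.
Qed.

Definition shears s (l : seq I) (x : E) : E := foldr (shear s) x l.

Lemma dist1_shears s l x : dist1 (shears s l x) x <= (size l)%:R * (`|s| * MX).
Proof.
elim: l => [|i l IHl] /=; first by rewrite dist1xx mul0r.
rewrite -natr1 mulrDl mul1r addrC (le_trans (dist1_triangle (shears s l x) _ _))//.
by rewrite lerD// dist1_shear.
Qed.

(** Each shear evaluates the field at a point that the earlier ones have moved by at most
    [size l * |s| * MX]. Multiplied by [|s| * KX], this is a second-order error, and the errors add
    up by $m^2+m\le(m+1)^2$. *)
Lemma coord_shears s l x j :
  `|coord j (shears s l x) - (coord j x + s * \sum_(i <- l | i == j) field i x)|
  <= (size l)%:R ^+ 2 * (KX * MX) * s ^+ 2.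
Proof.
elim: l => [|i l IHl] /=.
  by rewrite big_nil mulr0 addr0 subrr normr0 expr0n/= !mul0r.
set m : R := (size l)%:R in IHl *; have m0 : 0 <= m by [].
have P0 : 0 <= KX * MX * s ^+ 2 by apply: mulr_ge0; [exact: mulr_ge0|exact: sqr_ge0].
have mS : m ^+ 2 * (KX * MX) * s ^+ 2 + m * (KX * MX) * s ^+ 2 <=
    (size l).+1%:R ^+ 2 * (KX * MX) * s ^+ 2.
  have := mulr_ge0 (addr_ge0 m0 (@ler01 R)) P0; rewrite -natr1 -/m; lra.
rewrite big_cons; case: eqP => [->|/eqP ij]; rewrite coord_upd; last first.
  rewrite eq_sym (negbTE ij) (le_trans IHl)// (le_trans _ mS)// lerDl.
  by rewrite -mulrA mulr_ge0.
rewrite eqxx; set y := shears s l x in IHl *.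
rewrite (_ : _ - _ = (coord j y - (coord j x + s * \sum_(k <- l | k == j) field k x)) +
   s * (field j y - field j x)); last by ring.
rewrite (le_trans (ler_normD _ _))// (le_trans _ mS)// lerD//.
rewrite normrM (@le_trans _ _ (`|s| * (KX * (m * (`|s| * MX)))))//.
  rewrite ler_wpM2l// (le_trans (field_lip _ _ _))// ler_wpM2l//.
  exact: dist1_shears.
by rewrite -(real_normK (num_real s)); lra.
Qed.

Let vol := fine (@phase_measure R n (cube B)).

Let vol_ge0 : 0 <= vol. Proof. exact: fine_ge0. Qed.

Let D i x := peval (pder i (X i)) x.

(** Terms that already carry a factor [s] may use [psi] in place of the sheared [psi], at a total
    cost of order [s ^+ 2]. *)
Lemma pint_der_shear L psi B0 s i j : 0 <= L -> 0 <= B0 -> B0 < B ->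
  `|s| * MX <= B - B0 -> `|s| * KX <= 1 ->
  lipschitz L psi -> (forall x, ~ cube B0 x -> psi x = 0) ->
  `|pint (fun x => D j x * psi x) - pint (fun x => D j x * psi (shear s i x))| <=
  MD * L * MX * vol * `|s|.
Proof.
move=> L0 B00 B0B sM sK psiL psi0.
have t1 : test_fun B psi.
  split; first exact: lipschitz_on_cubes psiL.
  by move=> x h; apply: psi0 => c; apply: h; apply: cube_mono c; exact: ltW.
have t2 : test_fun B (psi \o shear s i).
  split; first by apply: (lipschitz_on_cubes _ (lipschitz_shear i L0 sK psiL)); rewrite mulr_ge0.
  move=> x h; apply: (@shear_supp psi B0 s i psi0) => c; apply: h; apply: cube_mono c.
  by rewrite -lerBrDl.
have d1 := test_funM t1 (lip_on_cubes_peval (pder j (X j))).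
have d2 := test_funM t2 (lip_on_cubes_peval (pder j (X j))).
rewrite -(pintB d1 d2).
have d12 : test_fun B (fun x => D j x * psi x - D j x * psi (shear s i x)).
  have := test_funD d1 (test_funZ (-1) d2).
  by under eq_fun do rewrite mulN1r.
rewrite (le_trans (le_pint (e := MD * (L * (`|s| * MX))) d12 _))//; last first.
  by rewrite -/vol; lra.
move=> x xB; rewrite -mulrBr normrM ler_pM// ?D_bound//.
by rewrite (le_trans (psiL _ _))// ler_wpM2l// dist1C dist1_shear.
Qed.

(** The outermost shear is absorbed into [psi], so the induction hypothesis is applied to
    [psi \o shear s i], a function that itself depends on [s]. This is why [C] and [s0] are chosen
    before [psi], and why [L] and [B0] vary in the induction: the former doubles, the latter
    grows. *)
Lemma pint_shears l L B0 : 0 <= L -> 0 <= B0 -> B0 < B ->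
  exists C s0, [/\ 0 <= C, 0 < s0 & forall s, `|s| <= s0 -> forall psi,
    lipschitz L psi -> (forall x, ~ cube B0 x -> psi x = 0) ->
    test_fun B (psi \o shears s l) /\
    `|pint (psi \o shears s l) - pint psi +
      s * \sum_(i <- l) pint (fun x => D i x * psi x)| <= C * s ^+ 2].
Proof.
elim: l L B0 => [|i l IHl] L B0 L0 B00 B0B.
  exists 0, 1; split => // s _ psi psiL psi0; split.
    split=> [|x h]; first exact: lipschitz_on_cubes psiL.
    by apply: psi0 => c; apply: h; apply: cube_mono c; exact: ltW.
  by rewrite big_nil mulr0 addr0 subrr normr0 mul0r.
(* Half of the margin is spent on the growth of the support under one shear, the other half is left
   to the remaining shears. *)
pose B1 := (B0 + B) / 2.
have B01 : B0 < B1 by rewrite /B1; lra.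
have B1B : B1 < B by rewrite /B1; lra.
have [|||C [s0 [C0 s00 IH]]] := IHl (2 * L) B1; [exact: mulr_ge0|by lra|by []|].
pose K := MD * L * MX * vol.
have K0 : 0 <= K by rewrite !mulr_ge0.
have MX1 : 0 < MX + 1 by have := MX_ge0; lra.
have KX1 : 0 < KX + 1 by have := KX_ge0; lra.
(* One [K] pays for unshearing the derivative term of [i], and [size l] more for those of the tail.
   The two quotients ensure [|s| * MX <= B1 - B0] and [|s| * KX <= 1]. *)
exists (C + (size l).+1%:R * K), (Num.min s0 (Num.min ((B1 - B0) / (MX + 1)) (1 / (KX + 1)))).
split.
- by rewrite addr_ge0// mulr_ge0.
- by rewrite !lt_min s00 !divr_gt0//; lra.
move=> s; rewrite !le_min => /and3P[ss0]; rewrite !ler_pdivlMr// => sM sK psi psiL psi0.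
have s_ge0 := normr_ge0 s.
have {}sM : `|s| * MX <= B1 - B0 by lra.
have {}sK : `|s| * KX <= 1 by lra.
have sMB : `|s| * MX <= B - B0 by lra.
have [] := IH s ss0 (psi \o shear s i) (lipschitz_shear i L0 sK psiL).
  move=> x h; apply: (@shear_supp psi B0 s i psi0) => c; apply: h; apply: cube_mono c; lra.
move=> tf IHs; split => //.
have ps := pint_shear i L0 B00 B0B sMB sK psiL psi0.
have pd j := pint_der_shear i j L0 B00 B0B sMB sK psiL psi0.
rewrite big_cons.
set S := \sum_(j <- l) _; set S' := \sum_(j <- l) _ in IHs.
have SS' : `|S - S'| <= (size l)%:R * (K * `|s|).
  rewrite /S /S' -sumrB (le_trans (ler_norm_sum _ _ _))//.
  have -> : (size l)%:R * (K * `|s|) = \sum_(j <- l) (K * `|s|).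
    by rewrite big_const_seq count_predT iter_addr_0 mulr_natl.
  by apply: ler_sum => j _; exact: pd.
have pdi := pd i; rewrite -/K in pdi.
rewrite -[pint (psi \o shears s (i :: l))]/(pint ((psi \o shear s i) \o shears s l)).
set u := pint (_ \o shears s l) in IHs *; set p := pint psi in ps *.
set p' := pint (psi \o shear s i) in ps IHs.
set d := pint (fun x => D i x * psi x) in pdi *.
set d' := pint (fun x => D i x * psi (shear s i x)) in pdi ps.
rewrite (_ : u - p + s * (d + S) = (u - p' + s * S') + s * (d - d') + s * (S - S')); last first.
  by rewrite -ps; ring.
rewrite (le_trans (ler_normD _ _))// (le_trans (lerD (ler_normD _ _) (lexx _)))//.
rewrite !normrM mulrDl -natr1 -(real_normK (num_real s)).
have h1 : `|s| * `|d - d'| <= `|s| * (K * `|s|) by rewrite ler_wpM2l.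
have h2 : `|s| * `|S - S'| <= `|s| * ((size l)%:R * (K * `|s|)) by rewrite ler_wpM2l.
rewrite -(real_normK (num_real s)) in IHs; lra.
Qed.

Hypothesis div_free : forall x, \sum_i D i x = 0.

(* A map that agrees with the Euler step [x + s X(x)] up to O(s^2) also agrees
   with a composition of shears up to O(s^2). *)
Lemma pint_near_euler_step A L B0 : 0 <= A -> 0 <= L -> 0 <= B0 -> B0 < B ->
  exists C s0, [/\ 0 <= C, 0 < s0 & forall s psi (G : E -> E), `|s| <= s0 ->
    lipschitz L psi -> (forall x, ~ cube B0 x -> psi x = 0) ->
    test_fun B (psi \o G) ->
    (forall x, cube B x ->
      dist1 (G x) (mkpt (fun i => coord i x + s * peval (X i) x)) <= A * s ^+ 2) ->
    `|pint (psi \o G) - pint psi| <= C * s ^+ 2].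
Proof.
move=> A0 L0 B00 B0B; pose l := index_enum I.
have [C [s0 [C0 s00 H]]] := pint_shears l L0 B00 B0B.
pose A' := \sum_(i : I) (size l)%:R ^+ 2 * (KX * MX).
have A'0 : 0 <= A' by apply: sumr_ge0 => i _; apply: mulr_ge0; [exact: sqr_ge0|exact: mulr_ge0].
exists (C + L * (A + A') * vol), s0; split => //.
  by rewrite addr_ge0// !mulr_ge0// addr_ge0.
move=> s psi G ss0 psiL psi0 tG hG; have [tS hS] := H s ss0 psi psiL psi0.
(* By linearity this is the integral of [psi] times the divergence: the only place where [div_free]
   enters. *)
have sum0 : \sum_(i <- l) pint (fun x => D i x * psi x) = 0.
  have t1 : test_fun B psi.
    split; first exact: lipschitz_on_cubes psiL.
    by move=> x h; apply: psi0 => c; apply: h; apply: cube_mono c; exact: ltW.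
  have t0 : test_fun B (fun _ : E => 0) by split=> //; exact: lip_on_cubes_cst.
  have p0 : pint (fun _ : E => 0) = 0 :> R.
    transitivity (pint (fun x => 0 * psi x)); last by rewrite (pintZ 0 t1) mul0r.
    apply: (congr1 (@pint R n)).
    by apply/funext => x; rewrite mul0r.
  have [tsum ->] : test_fun B (fun x => \sum_(i <- l) D i x * psi x) /\
      \sum_(i <- l) pint (fun x => D i x * psi x) = pint (fun x => \sum_(i <- l) D i x * psi x).
    elim: (l) => [|i k [IHt IHk]].
      have -> : (fun x => \sum_(i <- [::]) D i x * psi x) = (fun=> 0).
        by apply/funext => x; rewrite big_nil.
      by rewrite big_nil p0.
    have td := test_funM t1 (lip_on_cubes_peval (pder i (X i))).
    have -> : (fun x => \sum_(j <- i :: k) D j x * psi x) =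
        (fun x => D i x * psi x + \sum_(j <- k) D j x * psi x).
      by apply/funext => x; rewrite big_cons.
    split; first exact: (test_funD td IHt).
    by rewrite big_cons IHk (pintD td IHt).
  rewrite -[RHS]p0; apply: (congr1 (@pint R n)); apply/funext => x.
  by rewrite -mulr_suml div_free mul0r.
rewrite sum0 mulr0 addr0 in hS.
have -> : pint (psi \o G) - pint psi = (pint (psi \o G) - pint (psi \o shears s l)) +
   (pint (psi \o shears s l) - pint psi) by ring.
rewrite (le_trans (ler_normD _ _))// mulrDl addrC lerD//.
rewrite -(pintB tG tS).
have tGS : test_fun B (fun x => (psi \o G) x - (psi \o shears s l) x).
  have := test_funD tG (test_funZ (-1) tS).
  by under eq_fun do rewrite mulN1r.
rewrite (le_trans (le_pint (e := L * ((A + A') * s ^+ 2)) tGS _))//; last first.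
  by rewrite -/vol; lra.
move=> x xB; rewrite (le_trans (psiL _ _))// ler_wpM2l//.
rewrite (le_trans (dist1_triangle (mkpt (fun i => coord i x + s * peval (X i) x)) _ _))//.
rewrite mulrDl lerD//; first exact: hG.
rewrite dist1C /A' mulr_suml; apply: ler_sum => j _.
rewrite coord_mkpt (le_trans _ (coord_shears s l x j))//.
by rewrite big_pred1_eq /field clamp_id.
Qed.
End splitting.
(** * Flows of polynomial fields *)

Section real_ode.
Context (R : realType).

Lemma derive_within_continuous (f df : R -> R) (a b : R) :
  (forall t : R, is_derive t 1 f (df t)) -> {within `[a, b], continuous f}.
Proof.
by move=> fd; apply: continuous_subspaceT => x; exact: is_derive_continuous (fd x).
Qed.

Lemma mvt_at0 (f df : R -> R) (s : R) : (forall t : R, is_derive t 1 f (df t)) ->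
  exists2 c, `|c| <= `|s| & f s - f 0 = s * df c.
Proof.
move=> fd; have [s0|s0|->] := ltgtP s 0; last by exists 0; rewrite ?subrr ?mul0r.
  have [c] := MVT s0 (fun t _ => fd t) (derive_within_continuous (a := s) (b := 0) fd).
  rewrite in_itv/= => /andP[sc c0] e; exists c; first by rewrite !ltr0_norm// lerNr opprK ltW.
  by rewrite -[LHS]opprB e sub0r mulrN opprK mulrC.
have [c] := MVT s0 (fun t _ => fd t) (derive_within_continuous (a := 0) (b := s) fd).
rewrite in_itv/= => /andP[c0 cs] e; exists c; first by rewrite !gtr0_norm// ltW.
by rewrite e subr0 mulrC.
Qed.

Lemma is_derive_expRM (k t : R) : is_derive t 1 (fun s => expR (k * s)) (k * expR (k * t)).
Proof.
have h : is_derive t 1 (fun s : R => k * s) k.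
  by apply: (is_derive_eq (is_deriveZ k (is_derive_id t (1 : R)))); rewrite /GRing.scale/= mulr1.
rewrite mulrC; exact: (is_derive1_comp (f := expR) (g := fun s => k * s)).
Qed.

(** For nonnegative times [expR (- k * s) * w s] is nonincreasing, for negative times
    [expR (k * s) * w s] is nondecreasing; both directions are needed since flows run over all real
    times. *)
Lemma gronwall (w dw : R -> R) (k t : R) : (forall s : R, is_derive s 1 w (dw s)) ->
  (forall s, `|dw s| <= k * w s) -> w t <= expR (k * `|t|) * w 0.
Proof.
move=> wd dw_le.
have dg (c s : R) : is_derive s 1 (fun s => expR (c * s) * w s)
    (expR (c * s) * (dw s + c * w s)).
  apply: (is_derive_eq (is_deriveM (is_derive_expRM c s) (wd s))).
  by rewrite /GRing.scale/=; ring.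
have [t0|t0] := leP 0 t.
  have [c _] := MVT_segment t0 (fun s _ => dg (- k) s)
    (derive_within_continuous (a := 0) (b := t) (dg (- k))).
  rewrite mulr0 expR0 mul1r => e.
  have : expR (- k * t) * w t <= w 0.
    rewrite -subr_le0 e mulr_le0_ge0 ?subr0// pmulr_rle0 ?expR_gt0//.
    by have := dw_le c; rewrite ler_norml; lra.
  by rewrite mulNr expRN ger0_norm// mulrC ler_pdivrMr ?expR_gt0// mulrC.
have [c _] := MVT_segment (ltW t0) (fun s _ => dg k s)
  (derive_within_continuous (a := t) (b := 0) (dg k)).
rewrite mulr0 expR0 mul1r => e.
have : expR (k * t) * w t <= w 0.
  rewrite -subr_ge0 e; apply: mulr_ge0; last by rewrite sub0r oppr_ge0 ltW.
  apply: mulr_ge0; first exact: expR_ge0.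
  by have := dw_le c; rewrite ler_norml; lra.
rewrite ltr0_norm// mulrN expRN.
by rewrite mulrC -ler_pdivlMr ?expR_gt0// mulrC.
Qed.

Lemma is_derive0_quadratic (F : R -> R) (t C s0 : R) : 0 < s0 ->
  (forall s, `|s| <= s0 -> `|F (s + t) - F t| <= C * s ^+ 2) -> is_derive t 1 F 0.
Proof.
move=> s00 FC; have C0 : 0 <= C.
  have := FC s0; rewrite gtr0_norm// lexx => /(_ isT) /(le_trans (normr_ge0 _)).
  by rewrite pmulr_lge0// exprn_gt0.
have cv : h^-1 *: (F (h *: 1 + t) - F t) @[h --> 0^'] --> (0 : R).
  apply/cvgr0Pnorm_le => e e0; near=> h.
  have h0 : h != 0 by near: h; exact: nbhs_dnbhs_neq.
  have hn0 : 0 < `|h| by rewrite normr_gt0.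
  have [h1 h2] : `|h| <= s0 /\ `|h| <= e / (C + 1).
    split; near: h; apply: dnbhs0_le => //; rewrite divr_gt0//; lra.
  rewrite /GRing.scale/= mulr1 normrM normfV mulrC ler_pdivrMr//.
  rewrite (le_trans (FC h h1))// -(real_normK (num_real h)) expr2 mulrA.
  rewrite ler_wpM2r//; move: h2; rewrite ler_pdivlMr; lra.
split; first by apply/cvg_ex; exists 0; exact: cv.
exact: cvg_lim cv.
Unshelve. all: end_near. Qed.
End real_ode.

(** * Solutions of a polynomial field tangent to spheres *)

Section polynomial_flow.
Context (R : realType) (n : nat).
Local Notation E := (phase R n).
Local Notation I := ('I_n + 'I_n)%type.
Variable X : I -> rpoly R n.

Definition solves (u : R -> E) := forall (t : R) i,
  is_derive t 1 (fun s => coord i (u s)) (peval (X i) (u t)).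

(** For the coefficients of a trigonometric polynomial this is its mass, by Parseval. The dynamics
    is handled entirely in this Euclidean form. *)
Definition sqnorm (x : E) : R := \sum_i coord i x ^+ 2.

Lemma is_derive_sumI (h dh : I -> R -> R) (t : R) :
  (forall i, is_derive t 1 (h i) (dh i t)) ->
  is_derive t 1 (fun s => \sum_i h i s) (\sum_i dh i t).
Proof.
move=> hd; elim: (index_enum _) => [|i l IHl].
  under eq_fun do rewrite big_nil.
  by rewrite big_nil; exact: is_derive_cst.
under eq_fun do rewrite big_cons.
by rewrite big_cons; exact: is_deriveD.
Qed.

Lemma sqnorm_cube (r : R) x : 0 <= r -> sqnorm x <= r ^+ 2 -> cube r x.
Proof.
move=> r0 xr i; rewrite -ler_sqr ?nnegrE// real_normK ?num_real//.
rewrite (le_trans _ xr)// /sqnorm (bigD1 i)//= lerDl.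
by apply: sumr_ge0 => j _; exact: sqr_ge0.
Qed.

Lemma cube_sqnorm (r : R) x : 0 <= r -> cube r x -> sqnorm x <= (#|{: I}|.+1%:R * r) ^+ 2.
Proof.
move=> r0 xr; apply: (@le_trans _ _ (\sum_(i : I) r ^+ 2)).
  apply: ler_sum => i _; rewrite -(real_normK (num_real (coord i x))).
  by rewrite ler_sqr ?nnegrE.
rewrite sumr_const -[leLHS]mulr_natl exprMn ler_wpM2r ?sqr_ge0// -natrX ler_nat.
by rewrite (leq_trans (leqnSn _))// expnS expn1 leq_pmulr.
Qed.

Hypothesis conserved : forall x, \sum_i coord i x * peval (X i) x = 0.

Lemma sqnorm_solves u t : solves u -> sqnorm (u t) = sqnorm (u 0).
Proof.
move=> su; have [|c _] := @mvt_at0 _ (fun s => sqnorm (u s)) (fun=> 0) t _.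
  move=> s; have h : is_derive s 1 (fun t => \sum_i coord i (u t) ^+ 2)
      (\sum_i 2 * (coord i (u s) * peval (X i) (u s))).
    apply: (@is_derive_sumI (fun i t => coord i (u t) ^+ 2)
      (fun i t => 2 * (coord i (u t) * peval (X i) (u t)))) => i.
    under eq_fun do rewrite expr2.
    apply: (is_derive_eq (is_deriveM (su s i) (su s i))).
    by rewrite /GRing.scale/=; ring.
  by rewrite -mulr_sumr conserved mulr0 in h.
by rewrite mulr0 => /eqP; rewrite subr_eq0 => /eqP.
Qed.

(* Gronwall for the squared Euclidean distance of two orbits on a sphere. *)
Lemma dist1_solves (r : R) : 0 <= r -> exists k, forall u v t, solves u -> solves v ->
  sqnorm (u 0) <= r ^+ 2 -> sqnorm (v 0) <= r ^+ 2 ->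
  dist1 (u t) (v t) <= (#|{: I}|%:R * expR (k * `|t|) + 1) * dist1 (u 0) (v 0).
Proof.
move=> r0; have [M [K [M0 K0 _ KX]]] :=
  lip_on_cubes_uniform r (fun i => lip_on_cubes_peval (X i)).
pose d : R := #|{: I}|%:R; have d0 : 0 <= d by [].
exists (2 * K * d) => u v t su sv ur vr.
have uc s : cube r (u s) by apply: sqnorm_cube => //; rewrite sqnorm_solves.
have vc s : cube r (v s) by apply: sqnorm_cube => //; rewrite sqnorm_solves.
pose del i s := coord i (u s) - coord i (v s).
(* Unlike [dist1], the squared Euclidean distance is differentiable in time; the two are comparable
   up to the number [d] of coordinates. *)
pose w s := \sum_i del i s ^+ 2.
pose dw s := \sum_i 2 * (del i s * (peval (X i) (u s) - peval (X i) (v s))).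
have w_dist s : w s <= dist1 (u s) (v s) ^+ 2.
  rewrite expr2 mulr_suml; apply: ler_sum => i _.
  by rewrite -(real_normK (num_real (del i s))) expr2 ler_wpM2l// ler_coord_dist1.
have dist_w s : dist1 (u s) (v s) ^+ 2 <= d * w s.
  rewrite expr2 mulr_suml; under eq_bigr do rewrite mulr_sumr.
  (* Cauchy-Schwarz in the elementary form $|xy|\le(x^2+y^2)/2$, applied to all pairs of the
     expanded square. *)
  apply: (@le_trans _ _ (\sum_i \sum_j (del i s ^+ 2 + del j s ^+ 2) / 2)).
    apply: ler_sum => i _; apply: ler_sum => j _; rewrite -/(del i s) -/(del j s).
    rewrite -(real_normK (num_real (del i s))) -(real_normK (num_real (del j s))).
    have := sqr_ge0 (`|del i s| - `|del j s|); rewrite sqrrB; lra.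
  have sumE (x : R) : \sum_(i : I) x = d * x by rewrite sumr_const mulr_natl.
  under eq_bigr do under eq_bigr do rewrite mulrDl.
  under eq_bigr do rewrite big_split/= sumE -mulr_suml -/(w s).
  rewrite big_split/= sumE -mulr_sumr -mulr_suml -/(w s); lra.
have dwd (s : R) : is_derive s 1 w (dw s).
  apply: (@is_derive_sumI (fun i t => del i t ^+ 2)
    (fun i t => 2 * (del i t * (peval (X i) (u t) - peval (X i) (v t))))) => i.
  under eq_fun do rewrite expr2.
  have h := is_deriveB (su s i) (sv s i).
  apply: (is_derive_eq (is_deriveM h h)).
  by rewrite /GRing.scale/= /del !fctE; ring.
have dw_le s : `|dw s| <= 2 * K * d * w s.
  rewrite (le_trans (ler_norm_sum _ _ _))//.
  apply: (@le_trans _ _ (\sum_i 2 * (K * dist1 (u s) (v s)) * `|del i s|)).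
    apply: ler_sum => i _; rewrite !normrM ger0_norm// -mulrA ler_wpM2l//.
    by rewrite mulrC ler_wpM2r//; exact: KX.
  rewrite -mulr_sumr -/(dist1 (u s) (v s)).
  have := ler_wpM2l K0 (dist_w s); rewrite expr2; lra.
have wt := gronwall t dwd dw_le.
set k := 2 * K * d in wt *; set e := expR (k * `|t|) in wt *.
have e0 : 0 <= e by exact: expR_ge0.
have D0 := dist1_ge0 (u 0) (v 0); have de0 : 0 <= d * e by rewrite mulr_ge0.
(* The natural constant is $\sqrt{de}$; the bound $de\le(de+1)^2$ replaces the root by
   [d * e + 1]. *)
rewrite -ler_sqr ?nnegrE ?dist1_ge0//; last by rewrite mulr_ge0// addr_ge0.
rewrite (le_trans (dist_w t))// (le_trans (ler_wpM2l d0 wt))//.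
rewrite exprMn mulrA.
apply: (@le_trans _ _ (d * e * dist1 (u 0) (v 0) ^+ 2)); first by rewrite ler_wpM2l.
rewrite ler_wpM2r ?sqr_ge0// sqrrD -/d; have := sqr_ge0 (d * e); lra.
Qed.

(** Two mean value steps: a coordinate moves by [s] times the field at an intermediate time [c], and
    the orbit is by then within [d * M * |c|] of its start. No second derivative in time is
    needed. *)
Lemma euler_step_error (r : R) : 0 <= r -> exists2 A, 0 <= A & forall u s, solves u ->
  sqnorm (u 0) <= r ^+ 2 ->
  dist1 (u s) (mkpt (fun i => coord i (u 0) + s * peval (X i) (u 0))) <= A * s ^+ 2.
Proof.
move=> r0; have [M [K [M0 K0 MX KX]]] :=
  lip_on_cubes_uniform r (fun i => lip_on_cubes_peval (X i)).
pose d : R := #|{: I}|%:R; have d0 : 0 <= d by [].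
exists (d * (K * (d * M))); first by rewrite !mulr_ge0.
move=> u s su ur.
have uc t : cube r (u t) by apply: sqnorm_cube => //; rewrite sqnorm_solves.
have near0 c : dist1 (u c) (u 0) <= d * M * `|c|.
  rewrite -mulrA mulr_natl -sumr_const; apply: ler_sum => i _.
  have [b _ ->] := mvt_at0 c (fun t => su t i).
  by rewrite normrM mulrC ler_wpM2r//; exact: MX.
rewrite -!mulrA mulr_natl -sumr_const; apply: ler_sum => i _.
rewrite coord_mkpt opprD addrA; have [c cs ->] := mvt_at0 s (fun t => su t i).
rewrite -mulrBr normrM -(real_normK (num_real s)).
have -> : K * (d * (M * `|s| ^+ 2)) = `|s| * (K * (d * M * `|s|)) by ring.
rewrite ler_wpM2l// (le_trans (KX _ _ _ (uc c) (uc 0)))// ler_wpM2l//.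
by rewrite (le_trans (near0 c))// ler_wpM2l// mulr_ge0.
Qed.
End polynomial_flow.

(** * Lipschitz approximation of boxes, and boxes as a generating class *)

Section boxes.
Context (R : realType) (n : nat).
Local Notation E := (phase R n).
Local Notation I := ('I_n + 'I_n)%type.
Implicit Types a b : I -> R.

Definition depth a b (x : E) : R :=
  \big[Num.min/1]_i Num.min (coord i x - a i) (b i - coord i x).

(** [depth] is positive exactly on the open box, so these functions increase with [m] to its
    indicator and monotone convergence applies. *)
Definition bump a b (m : nat) (x : E) : R := Num.max 0 (Num.min 1 (m%:R * depth a b x)).

Lemma depth_lip a b : lipschitz 1 (depth a b).
Proof.
have h x y : depth a b x - dist1 x y <= depth a b y.
  apply/bigmin_geP; split.
    have := bigmin_le_id (index_enum I) 1 xpredT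
      (fun i => Num.min (coord i x - a i) (b i - coord i x)).
    by rewrite -/(depth a b x); have := dist1_ge0 x y; lra.
  move=> i _; have : depth a b x <= Num.min (coord i x - a i) (b i - coord i x).
    exact: bigmin_le.
  have := ler_coord_dist1 i x y.
  by rewrite ler_norml !le_min => /andP[? ?] /andP[? ?]; apply/andP; split; lra.
move=> x y; rewrite mul1r ler_norml; have := h x y; have := h y x.
by rewrite dist1C; lra.
Qed.

Lemma depth_gt0 a b x : (0 < depth a b x) <-> phase_box a b x.
Proof.
split=> [/bigmin_gtP[_ h] i|h].
  by have := h i isT; rewrite lt_min !subr_gt0.
by apply/bigmin_gtP; split => // i _; rewrite lt_min !subr_gt0; exact: h.
Qed.

Lemma bump_ge0 a b m x : 0 <= bump a b m x.
Proof. by rewrite le_max lexx. Qed.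

Lemma bump_out a b m x : ~ phase_box a b x -> bump a b m x = 0.
Proof.
move=> h; have d0 : depth a b x <= 0.
  by rewrite leNgt; apply/negP => /depth_gt0.
apply/max_l; rewrite ge_min; apply/orP; right.
by rewrite mulr_ge0_le0.
Qed.

Lemma bump_lip a b m : lipschitz m%:R (bump a b m).
Proof.
move=> x y; rewrite (@le_trans _ _ `|m%:R * depth a b x - m%:R * depth a b y|)//.
  rewrite /bump; set u := m%:R * _; set v := m%:R * _.
  rewrite /Num.max /Num.min.
  by repeat case: ifPn; rewrite -?leNgt => *; rewrite ler_norml;
    have := ler_norm (u - v); have := ler_norm (v - u); rewrite distrC => *; lra.
rewrite -mulrBr normrM ger0_norm// ler_wpM2l//.
by have := depth_lip a b x y; rewrite mul1r.
Qed.

Lemma bump_nd a b x : nondecreasing_seq (fun m => bump a b m x).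
Proof.
move=> m k mk; have [xb|xb] := pselect (phase_box a b x); last by rewrite !bump_out.
have d0 : 0 <= depth a b x by apply/ltW/depth_gt0.
rewrite /bump ge_max le_max lexx/= le_max; apply/orP; right.
rewrite le_min ge_min lexx/= ge_min; apply/orP; right.
by rewrite ler_wpM2r// ler_nat.
Qed.

Lemma bump_cvg a b x : bump a b m x @[m --> \oo] --> (\1_(phase_box a b) x : R).
Proof.
have [xb|xb] := pselect (phase_box a b x); last first.
  under eq_cvg do rewrite bump_out//.
  by rewrite indicE memNset//; exact: cvg_cst.
rewrite indicE mem_set//; apply: cvg_near_cst; near=> m.
have d0 : 0 < depth a b x by apply/depth_gt0.
rewrite /bump min_l ?max_r//.
rewrite -ler_pdivrMr//; near: m; exact: nbhs_infty_ger.
Unshelve. all: end_near. Qed.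

Lemma integral_bump_cvg (mu : {measure set E -> \bar R}) (f : E -> E) a b :
  measurable_fun setT f ->
  (\int[mu]_x (bump a b m (f x))%:E)%E @[m --> \oo] --> mu (f @^-1` phase_box a b).
Proof.
move=> mf; have mb := @measurable_phase_box R n a b.
have mfb : measurable (f @^-1` phase_box a b).
  by rewrite -[X in measurable X]setTI; exact: mf.
have -> : mu (f @^-1` phase_box a b) =
    (\int[mu]_x limn (fun m => (bump a b m (f x))%:E))%E.
  rewrite -[X in mu X]setIT -(integral_indic mu measurableT mfb).
  apply: eq_integral => x _; apply/esym/cvg_lim => //.
  by apply: cvg_EFin; [exact: nearW|exact: bump_cvg].
apply: cvg_monotone_convergence => //.
- move=> m; apply/measurable_EFinP; apply: measurableT_comp => //.
  apply: measurable_lip_on_cubes; apply: lipschitz_on_cubes (bump_lip a b m); exact: ler0n.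
- by move=> m x _; rewrite lee_fin bump_ge0.
- by move=> x _ m k mk; rewrite lee_fin; exact: bump_nd.
Qed.

Definition boxes : set (set E) := [set A | exists a b, A = phase_box a b].

Lemma boxes_setI : setI_closed boxes.
Proof.
move=> _ _ [a [b ->]] [a' [b' ->]].
exists (fun i => Num.max (a i) (a' i)), (fun i => Num.min (b i) (b' i)).
apply/seteqP; split => [x [h h'] i|x h].
  have /andP[h1 h2] := h i; have /andP[h3 h4] := h' i.
  by rewrite gt_max lt_min h1 h2 h3 h4.
by split=> i; have := h i; rewrite gt_max lt_min => /andP[/andP[h1 h2] /andP[h3 h4]];
  apply/andP.
Qed.

Lemma measurable_boxes : @measurable _ E = <<s boxes >>.
Proof.
apply/seteqP; split; last first.
  apply: smallest_sub; first exact: sigma_algebra_measurable.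
  by move=> _ [a [b ->]]; exact: measurable_phase_box.
(* With the same points and the sigma-algebra generated by boxes, the claim becomes measurability of
   the identity, which is checked on coordinates: a set [u < coord i x] is a countable union of
   growing boxes. *)
pose T := g_sigma_algebraType boxes.
have mid : measurable_fun [set: T] (id : T -> E).
  apply: measurable_to_phase => i.
  apply: (measurability _ (RGenOInfty.measurableE R)).
  move=> _ [_ [u ->] <-]; rewrite setTI.
  have -> : (coord i \o (id : T -> E)) @^-1` `]u, +oo[ =
      \bigcup_m phase_box (fun j => if j == i then u else - m%:R) (fun=> m%:R).
    apply/seteqP; split=> [x|x [m _] /(_ i)] /=; last first.
      by rewrite eqxx in_itv/= andbT => /andP[].
    rewrite in_itv/= andbT => ux.
    have [B B0 xB] := in_some_cube (x : E).
    exists (Num.truncn B).+1 => // j.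
    have Bm := truncnS_gt B; have := xB j; rewrite ler_norml => /andP[xB1 xB2].
    apply/andP; split; last by lra.
    by case: eqP => [->//|_]; lra.
  apply: bigcupT_measurable => m; apply: sub_sigma_algebra.
  by exists (fun j => if j == i then u else - m%:R), (fun=> m%:R).
by move=> A mA; have := mid measurableT A mA; rewrite setTI.
Qed.

Lemma boxes_measure_unique (m1 m2 : {measure set E -> \bar R}) :
  (forall B, (m1 (cube B) < +oo)%E) ->
  (forall a b, m1 (phase_box a b) = m2 (phase_box a b)) ->
  forall A, measurable A -> m1 A = m2 A.
Proof.
move=> fin m12; apply: (measure_unique boxes
  (fun k => phase_box (fun=> - k%:R) (fun=> k%:R)) measurable_boxes boxes_setI).
- by move=> k; exists (fun=> - k%:R), (fun=> k%:R).
- apply/seteqP; split=> // x _; have [B B0 xB] := in_some_cube x.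
  exists (Num.truncn B).+1 => // j.
  by have Bm := truncnS_gt B; have := xB j; rewrite ler_norml; lra.
- by move=> _ [a [b ->]].
- move=> k; apply: le_lt_trans (fin k%:R); apply: le_measure; rewrite ?inE.
  + exact: measurable_phase_box.
  + exact: measurable_cube.
  + by move=> x xk i; have := xk i; rewrite ler_norml => /andP[/ltW -> /ltW ->].
Qed.
End boxes.

(** * Liouville's theorem for a polynomial flow *)

Section liouville.
Context (R : realType) (n : nat).
Local Notation E := (phase R n).
Local Notation I := ('I_n + 'I_n)%type.
Variables (X : I -> rpoly R n) (Phi : R -> E -> E).
Hypothesis conserved : forall x, \sum_i coord i x * peval (X i) x = 0.
Hypothesis div_free : forall x, \sum_i peval (pder i (X i)) x = 0.
Hypothesis Phi0 : forall x, Phi 0 x = x.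
Hypothesis Phi_solves : forall x, solves X (Phi ^~ x).

Lemma sqnorm_flow t x : sqnorm (Phi t x) = sqnorm x.
Proof. by rewrite (sqnorm_solves conserved t (Phi_solves x)) Phi0. Qed.

Lemma dist1_flow (t r : R) : 0 <= r -> exists2 C, 0 <= C & forall x y,
  sqnorm x <= r ^+ 2 -> sqnorm y <= r ^+ 2 ->
  dist1 (Phi t x) (Phi t y) <= C * dist1 x y.
Proof.
move=> r0; have [k H] := dist1_solves conserved r0.
exists (#|{: I}|%:R * expR (k * `|t|) + 1).
  by rewrite addr_ge0// mulr_ge0// expR_ge0.
move=> x y xr yr; have := H _ _ t (Phi_solves x) (Phi_solves y).
by rewrite !Phi0; exact.
Qed.

(** The group law comes from uniqueness: both sides solve the equation in [t] with the same initial
    point, and [dist1_solves] at initial distance zero identifies them. *)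
Lemma flowD s t x : Phi (s + t) x = Phi t (Phi s x).
Proof.
have shift : solves X (fun t => Phi (s + t) x).
  move=> a i; have h1 : is_derive a 1 (fun t => s + t) 1.
    by rewrite -[X in is_derive _ _ _ X]add0r; exact: is_deriveD.
  have h2 := Phi_solves x (s + a) i.
  have := is_derive1_comp (f := fun t => coord i (Phi t x)) (g := fun t => s + t) (x := a).
  by move=> /(_ _ _ h2 h1); rewrite mulr1.
have [r r0 xr] := in_some_cube x.
have := cube_sqnorm r0 xr; set r' := _ * r => xr'.
have r'0 : 0 <= r' by rewrite mulr_ge0.
have [k H] := dist1_solves conserved r'0.
have := H _ _ t shift (Phi_solves (Phi s x)); rewrite /= addr0 Phi0 dist1xx mulr0.
rewrite !sqnorm_flow => /(_ xr' xr') d0; apply: eq_phase => i.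
apply/eqP; rewrite -subr_eq0 -normr_le0 (le_trans _ d0)//.
exact: (ler_coord_dist1 i).
Qed.

Lemma lip_on_cubes_flow t i : lip_on_cubes (fun x => coord i (Phi t x)).
Proof.
move=> B; have [B0|B0] := leP 0 B; last first.
  exists 0 => // x y xB _; exfalso; have := xB i.
  by have := normr_ge0 (coord i x); lra.
have rB0 : 0 <= #|{: I}|.+1%:R * B by rewrite mulr_ge0.
have [C C0 H] := dist1_flow t rB0; exists C => // x y xB yB.
rewrite (le_trans (ler_coord_dist1 i _ _))// H//; exact: cube_sqnorm.
Qed.

Lemma measurable_flow t : measurable_fun setT (Phi t).
Proof.
apply: measurable_to_phase => i; apply: measurable_lip_on_cubes.
exact: lip_on_cubes_flow.
Qed.

Lemma sqnorm_le_dist1 (x y : E) : sqnorm x <= 2 * sqnorm y + 2 * dist1 x y ^+ 2.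
Proof.
apply: (@le_trans _ _ (\sum_i (2 * coord i y ^+ 2 +
    2 * (coord i x - coord i y) ^+ 2))).
  apply: ler_sum => i _; have := sqr_ge0 (coord i x - 2 * coord i y).
  rewrite !sqrrB exprMn; lra.
rewrite big_split/= -!mulr_sumr lerD2l ler_wpM2l//.
rewrite [leRHS]expr2 mulr_suml; apply: ler_sum => i _.
by rewrite -real_normK ?num_real// expr2 ler_wpM2l// ler_coord_dist1.
Qed.

(** Within the ball of radius [2 * r] the flow is Lipschitz. If one point is outside, [phi] vanishes
    on its orbit; the other point is then either outside radius [r], with value 0 as well, or at
    distance at least [r], so that the bound [M] of [phi] is at most [M / r] times the distance. *)
Lemma lipschitz_flow (phi : E -> R) L r t : 0 <= L -> 0 < r -> lipschitz L phi ->
  (forall x, r ^+ 2 < sqnorm x -> phi x = 0) ->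
  exists2 L', 0 <= L' & lipschitz L' (phi \o Phi t).
Proof.
move=> L0 r0 phiL phi0.
have tphi : test_fun r phi.
  split; first exact: lipschitz_on_cubes phiL.
  move=> x h; apply: phi0; rewrite ltNge; apply/negP => xr; apply: h.
  by apply: sqnorm_cube => //; exact: ltW.
have [M M0 phiM] := test_fun_bounded tphi.
have r2 : 0 <= 2 * r by lra.
have [C C0 HC] := dist1_flow t r2.
exists (L * C + M / r); first by rewrite addr_ge0 ?mulr_ge0// invr_ge0 ltW.
have Mr0 : 0 <= M / r by rewrite divr_ge0// ltW.
have near x y : sqnorm x <= (2 * r) ^+ 2 -> sqnorm y <= (2 * r) ^+ 2 ->
    `|phi (Phi t x) - phi (Phi t y)| <= L * C * dist1 x y + M / r * dist1 x y.
  move=> xr yr; have : 0 <= M / r * dist1 x y by rewrite mulr_ge0// dist1_ge0.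
  have := ler_wpM2l L0 (HC _ _ xr yr); have := phiL (Phi t x) (Phi t y); lra.
have far x y : (2 * r) ^+ 2 < sqnorm x ->
    `|phi (Phi t x) - phi (Phi t y)| <= L * C * dist1 x y + M / r * dist1 x y.
  move=> xr; have D0 := dist1_ge0 x y.
  have LCD : 0 <= L * C * dist1 x y by rewrite !mulr_ge0.
  have MD : 0 <= M / r * dist1 x y by rewrite mulr_ge0.
  have r20 : 0 < r ^+ 2 by rewrite exprn_gt0.
  rewrite phi0; last by rewrite sqnorm_flow; move: xr; rewrite exprMn; lra.
  rewrite sub0r normrN; have [yr|yr] := leP (sqnorm y) (r ^+ 2); last first.
    by rewrite phi0 ?sqnorm_flow// normr0 addr_ge0.
  (* From $4r^2<|x|^2\le 2|y|^2+2\,\mathrm{dist}^2\le 2r^2+2\,\mathrm{dist}^2$; this is what the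
     radius [2 * r] is for. *)
  have rD : r <= dist1 x y.
    rewrite -ler_sqr ?nnegrE// ?(ltW r0)//.
    by have := sqnorm_le_dist1 x y; move: xr; rewrite exprMn; lra.
  have : M <= M / r * dist1 x y.
    by rewrite mulrAC ler_pdivlMr// ler_wpM2l.
  by have := phiM (Phi t y); lra.
move=> x y; rewrite mulrDl /=.
have [xr|xr] := leP (sqnorm x) ((2 * r) ^+ 2); last exact: far.
have [yr|yr] := leP (sqnorm y) ((2 * r) ^+ 2); first exact: near.
by rewrite distrC dist1C; exact: far.
Qed.

Lemma pint_flow (phi : E -> R) L r t : 0 <= L -> 0 < r -> lipschitz L phi ->
  (forall x, r ^+ 2 < sqnorm x -> phi x = 0) ->
  pint (phi \o Phi t) = pint phi.
Proof.
move=> L0 r0 phiL phi0.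
have -> : pint phi = pint (phi \o Phi 0).
  by congr pint; apply/funext => x /=; rewrite Phi0.
apply: (is_derive_0_is_cst (f := fun t => pint (phi \o Phi t))) => {}t.
(* Any [B] above [r] would do: conservation keeps the support of [phi \o Phi a] in [cube r] for all
   times [a], and the gap leaves room for the shears. *)
pose B := r + 1; have rB : r < B by rewrite /B; lra.
have B0 : 0 <= B by lra.
have [M [K [M0 K0 MX KX]]] := lip_on_cubes_uniform B (fun i => lip_on_cubes_peval (X i)).
have [MD [K' [MD0 _ DX _]]] :=
  lip_on_cubes_uniform B (fun i => lip_on_cubes_peval (pder i (X i))).
have dB0 : 0 <= #|{: I}|.+1%:R * B by rewrite mulr_ge0.
have [A A0 HA] := euler_step_error conserved dB0.
have [L' L'0 psiL] := lipschitz_flow t L0 r0 phiL phi0.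
have phi_supp a x : ~ cube r x -> phi (Phi a x) = 0.
  move=> h; apply: phi0; rewrite sqnorm_flow ltNge; apply/negP => xr; apply: h.
  by apply: sqnorm_cube => //; exact: ltW.
have [C [s0 [C0 s00 H]]] :=
  pint_near_euler_step B0 M0 K0 MD0 MX KX DX div_free A0 L'0 (ltW r0) rB.
apply: (@is_derive0_quadratic _ _ t C s0 s00) => s ss0.
have -> : pint (phi \o Phi (s + t)) = pint ((phi \o Phi t) \o Phi s).
  by congr pint; apply/funext => x /=; rewrite flowD.
apply: H => // [x||x xB]; first exact: phi_supp.
- split=> [|x h /=].
    have [L'' L''0 psiL'] := lipschitz_flow (s + t) L0 r0 phiL phi0.
    have -> : (phi \o Phi t) \o Phi s = phi \o Phi (s + t).
      by apply/funext => x /=; rewrite flowD.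
    exact: lipschitz_on_cubes psiL'.
  by rewrite -flowD phi_supp// => c; apply: h; apply: cube_mono c; exact: ltW.
- have := HA (Phi ^~ x) s (Phi_solves x); rewrite Phi0; apply.
  exact: cube_sqnorm.
Qed.

Lemma bump_supp (a b : I -> R) : exists2 r, 0 < r & forall m x,
  r ^+ 2 < sqnorm x -> bump a b m x = 0.
Proof.
pose c : R := \sum_i (`|a i| + `|b i|).
have c0 : 0 <= c by apply: sumr_ge0 => i _; rewrite addr_ge0.
exists (#|{: I}|.+1%:R * (c + 1)); first by rewrite mulr_gt0// ltr_wpDl.
move=> m x xr; apply: bump_out => xb.
move: xr; rewrite ltNge => /negP; apply; apply: cube_sqnorm; first by rewrite addr_ge0.
move=> i; have ci : `|a i| + `|b i| <= c.
  by rewrite /c (bigD1 i)//= lerDl; apply: sumr_ge0 => j _; rewrite addr_ge0.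
have := xb i; have := ler_norm (b i); have := ler_norm (- a i); rewrite normrN.
have := normr_ge0 (b i); have := normr_ge0 (a i).
by rewrite ler_norml => *; apply/andP; split; lra.
Qed.

Theorem flow_invariant t A : measurable A ->
  phase_measure (Phi t @^-1` A) = phase_measure A.
Proof.
move=> mA; have mPhi := measurable_flow t.
pose m1 : {measure set E -> \bar R} := @phase_measure R n.
pose m2 : {measure set E -> \bar R} := pushforward m1 (Phi t).
suff h : forall A, measurable A -> m1 A = m2 mPhi A by rewrite [RHS](h _ mA).
apply: boxes_measure_unique; first exact: phase_measure_cube_lty.
move=> a b; have [r r0 supp] := bump_supp a b.
have bump_test m s : test_fun r (bump a b m \o Phi s).
  have [L' L'0 L'lip] := lipschitz_flow s (ler0n R m) r0 (bump_lip a b m) (supp m).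
  split; first exact: lipschitz_on_cubes L'lip.
  move=> x h; apply: supp; rewrite sqnorm_flow ltNge; apply/negP => xr; apply: h.
  by apply: sqnorm_cube => //; exact: ltW.
(* [pint_flow] compares real numbers; since both integrals are finite, the equality lifts to the
   extended values needed for the limit. *)
have e m : (\int[m1]_x (bump a b m (Phi t x))%:E =
            \int[m1]_x (bump a b m x)%:E)%E.
  have h1 := test_fun_integrable (bump_test m t).
  have h2 := test_fun_integrable (bump_test m 0).
  have := pint_flow t (ler0n R m) r0 (bump_lip a b m) (supp m).
  have Phi0E : bump a b m \o Phi 0 = bump a b m by apply/funext => x /=; rewrite Phi0.
  rewrite Phi0E in h2; rewrite /pint /Rintegral => h.
  have f1 := integrable_fin_num measurableT h1.
  have f2 := integrable_fin_num measurableT h2.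
  by rewrite -(fineK f1) -(fineK f2) h.
have c1 := @integral_bump_cvg R n m1 (Phi t) a b mPhi.
have c2 := @integral_bump_cvg R n m1 id a b (@measurable_id _ E setT).
rewrite preimage_id in c2.
rewrite -[LHS](cvg_lim (@ereal_hausdorff R) c2) -[RHS](cvg_lim (@ereal_hausdorff R) c1).
by apply: (congr1 (fun u => limn u)); apply/funext => m; exact/esym/e.
Qed.
End liouville.
(** * Trigonometric polynomials with polynomial coefficients *)

Local Open Scope complex_scope.
Import ComplexField.Normc.

Section circle_integrals.
Context (R : realType).
Local Notation leb := (@lebesgue_measure R).

Lemma two_pi_gt0 : 0 < 2 * pi :> R.
Proof. by rewrite mulr_gt0 ?pi_gt0. Qed.

Lemma cexpD (m p : int) (x : R) : cexp (m + p) x = cexp m x * cexp p x.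
Proof.
rewrite /cexp intrD mulrDl cosD sinD; apply/eqP; rewrite eq_complex /=.
by apply/andP; split; apply/eqP; ring.
Qed.

Lemma cexp0 (x : R) : cexp 0 x = 1.
Proof. by rewrite /cexp mul0r cos0 sin0. Qed.

Lemma cexpNK (m : int) (x : R) : cexp m x * cexp (- m) x = 1.
Proof. by rewrite -cexpD subrr cexp0. Qed.

Lemma cexpN (m : int) (x : R) : cexp (- m) x = conjc (cexp m x).
Proof. by rewrite /cexp intrN mulNr cosN sinN. Qed.

Lemma cexp_2pi (m : int) : cexp m (2 * pi) = 1 :> R[i].
Proof.
have h1 : cexp 1 (2 * pi) = 1 :> R[i].
  rewrite /cexp mul1r (_ : 2 * pi = pi + pi :> R); last by ring.
  by rewrite cosD sinD cospi sinpi mulrNN !mul0r !mulr0 mulr1 addr0 subr0.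
have hn (k : nat) : cexp k%:Z (2 * pi) = 1 :> R[i].
  elim: k => [|k IHk]; first exact: cexp0.
  by rewrite -addn1 PoszD cexpD IHk h1 mulr1.
case: m => k; first exact: hn.
by rewrite NegzE -[LHS]mul1r -(hn k.+1) cexpNK.
Qed.

Lemma is_derive_cosM (a x : R) : is_derive x 1 (fun y => cos (a * y)) (- (a * sin (a * x))).
Proof.
have h : is_derive x 1 (fun y : R => a * y) a.
  by apply: (is_derive_eq (is_deriveZ a (is_derive_id x (1 : R)))); rewrite /GRing.scale/= mulr1.
rewrite -mulrN mulrC; exact: (is_derive1_comp (f := cos) (g := fun y => a * y)).
Qed.

Lemma is_derive_sinM (a x : R) : is_derive x 1 (fun y => sin (a * y)) (a * cos (a * x)).
Proof.
have h : is_derive x 1 (fun y : R => a * y) a.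
  by apply: (is_derive_eq (is_deriveZ a (is_derive_id x (1 : R)))); rewrite /GRing.scale/= mulr1.
rewrite mulrC; exact: (is_derive1_comp (f := sin) (g := fun y => a * y)).
Qed.

Lemma circle_int_derive (F f : R -> R) : (forall x : R, is_derive x 1 F (f x)) ->
  continuous f -> F (2 * pi) = F 0 -> circle_int f = 0.
Proof.
move=> Fd cf F0; rewrite /circle_int /Rintegral.
have -> : (\int[leb]_(x in `[0%R, (2 * pi)%R]) (f x)%:E = (F (2 * pi) - F 0)%:E)%E.
  by apply: FTC2_is_derive => [|x _]; [exact: two_pi_gt0|exact: cf].
by rewrite F0 subrr.
Qed.

Lemma continuous_cosM (a : R) : continuous (fun x => cos (a * x)).
Proof. by move=> x; exact: is_derive_continuous (is_derive_cosM a x). Qed.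

Lemma continuous_sinM (a : R) : continuous (fun x => sin (a * x)).
Proof. by move=> x; exact: is_derive_continuous (is_derive_sinM a x). Qed.

Lemma circle_int_cexp (m : int) : m != 0 ->
  circle_int (fun x => cos (m%:~R * x)) = 0 :> R /\
  circle_int (fun x => sin (m%:~R * x)) = 0 :> R.
Proof.
move=> m0; have a0 : m%:~R != 0 :> R by rewrite intr_eq0.
have := cexp_2pi m; rewrite /cexp => /eqP; rewrite eq_complex /= => /andP[/eqP c1 /eqP s0].
set a : R := m%:~R in a0 c1 s0 *; split.
- apply: (@circle_int_derive (fun x => a^-1 * sin (a * x))).
  + move=> x; apply: (is_derive_eq (is_deriveZ a^-1 (is_derive_sinM a x))).
    by rewrite /GRing.scale/= mulrA mulVf// mul1r.
  + exact: continuous_cosM.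
  + by rewrite s0 !mulr0 sin0 mulr0.
- apply: (@circle_int_derive (fun x => - a^-1 * cos (a * x))).
  + move=> x; apply: (is_derive_eq (is_deriveZ (- a^-1) (is_derive_cosM a x))).
    by rewrite /GRing.scale/= mulrNN mulrA mulVf// mul1r.
  + exact: continuous_sinM.
  + by rewrite c1 mulr0 cos0.
Qed.

Lemma integrable_circle (f : R -> R) : continuous f ->
  leb.-integrable `[0, 2 * pi] (EFin \o f).
Proof.
move=> cf; apply: continuous_compact_integrable; first exact: segment_compact.
exact: continuous_subspaceT.
Qed.

Lemma circle_intD (f g : R -> R) : continuous f -> continuous g ->
  circle_int (fun x => f x + g x) = circle_int f + circle_int g.
Proof. by move=> cf cg; apply: RintegralD => //; exact: integrable_circle. Qed.

Lemma circle_intZ (f : R -> R) (a : R) : continuous f ->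
  circle_int (fun x => a * f x) = a * circle_int f.
Proof. by move=> cf; apply: RintegralZl => //; exact: integrable_circle. Qed.

Lemma circle_int_cst (a : R) : circle_int (fun=> a) = 2 * pi * a.
Proof.
have e : leb `[0, 2 * pi]%classic = (2 * pi)%:E.
  by rewrite lebesgue_measure_itv/= lte_fin two_pi_gt0 -EFinB subr0.
by rewrite /circle_int Rintegral_cst// [X in fine X]e mulrC.
Qed.

Definition ccontinuous (f : R -> R[i]) :=
  continuous (fun x => complex.Re (f x)) /\ continuous (fun x => complex.Im (f x)).

Lemma circle_intCD (f g : R -> R[i]) : ccontinuous f -> ccontinuous g ->
  circle_intC (fun x => f x + g x) = circle_intC f + circle_intC g.
Proof.
move=> [fr fi] [gr gi]; rewrite /circle_intC.
rewrite (_ : (fun x => complex.Re (f x + g x)) =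
    fun x => complex.Re (f x) + complex.Re (g x)); last first.
  by apply/funext => x; case: (f x) (g x) => [a b] [a' b'].
rewrite (_ : (fun x => complex.Im (f x + g x)) =
    fun x => complex.Im (f x) + complex.Im (g x)); last first.
  by apply/funext => x; case: (f x) (g x) => [a b] [a' b'].
by rewrite !circle_intD.
Qed.

Lemma ccontinuousD (f g : R -> R[i]) : ccontinuous f -> ccontinuous g ->
  ccontinuous (fun x => f x + g x).
Proof.
move=> [fr fi] [gr gi]; split.
  rewrite (_ : (fun x => complex.Re (f x + g x)) = fun x => complex.Re (f x) + complex.Re (g x)).
    by move=> x; apply: cvgD; [exact: fr|exact: gr].
  by apply/funext => x; case: (f x) (g x) => [a b] [a' b'].
rewrite (_ : (fun x => complex.Im (f x + g x)) = fun x => complex.Im (f x) + complex.Im (g x)).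
  by move=> x; apply: cvgD; [exact: fi|exact: gi].
by apply/funext => x; case: (f x) (g x) => [a b] [a' b'].
Qed.

Lemma ccontinuous_cexp (z : R[i]) (m : int) : ccontinuous (fun x => z * cexp m x).
Proof.
case: z => a b; split=> x.
  rewrite /cexp /=; apply: cvgB; apply: cvgM; try exact: cvg_cst.
    exact: continuous_cosM.
  exact: continuous_sinM.
rewrite /cexp /=; apply: cvgD; apply: cvgM; try exact: cvg_cst.
  exact: continuous_sinM.
exact: continuous_cosM.
Qed.

Lemma circle_intC_cexp (z : R[i]) (m : int) :
  circle_intC (fun x => z * cexp m x) = if m == 0 then (2 * pi)%:C * z else 0.
Proof.
case: z => a b; have cc := @continuous_cosM m%:~R; have cs := @continuous_sinM m%:~R.
have cM (u : R) (f : R -> R) : continuous f -> continuous (fun x => u * f x).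
  by move=> cf x; apply: cvgM; [exact: cvg_cst|exact: cf].
rewrite /circle_intC /=.
rewrite (_ : (fun x => a * cos (m%:~R * x) - b * sin (m%:~R * x)) =
  (fun x => a * cos (m%:~R * x) + (- b) * sin (m%:~R * x))); last first.
  by apply/funext => x; rewrite mulNr.
rewrite !circle_intD ?circle_intZ//; try exact: cM.
have [->|m0] := eqVneq m 0; last first.
  by have [-> ->] := circle_int_cexp m0; rewrite !mulr0 addr0.
have -> : (fun x : R => cos (0%:~R * x)) = fun=> 1.
  by apply/funext => x; rewrite mul0r cos0.
have -> : (fun x : R => sin (0%:~R * x)) = fun=> 0.
  by apply/funext => x; rewrite mul0r sin0.
rewrite !circle_int_cst !mulr0 mulr1 addr0 add0r.
by apply/eqP; rewrite eq_complex /= !mul0r subr0 addr0 !(mulrC (2 * pi)) !eqxx.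
Qed.

(** Orthogonality of the characters. Frequencies may repeat in [s], so the terms of frequency [m]
    are collected; continuity is carried through the induction because additivity of the integral
    needs it. *)
Lemma fourier_trig (s : seq (R[i] * int)) (m : int) :
  fourier (fun x => \sum_(q <- s) q.1 * cexp q.2 x) m = \sum_(q <- s | q.2 == m) q.1.
Proof.
rewrite /fourier.
have -> : (fun x => (\sum_(q <- s) q.1 * cexp q.2 x) * cexp (- m) x) =
    (fun x => \sum_(q <- s) q.1 * cexp (q.2 - m) x).
  by apply/funext => x; rewrite mulr_suml; apply: eq_bigr => q _; rewrite -mulrA -cexpD.
have [_ ->] : ccontinuous (fun x => \sum_(q <- s) q.1 * cexp (q.2 - m) x) /\
    circle_intC (fun x => \sum_(q <- s) q.1 * cexp (q.2 - m) x) =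
    (2 * pi)%:C * \sum_(q <- s | q.2 == m) q.1.
  elim: s => [|q s [IHc IHs]].
    have -> : (fun x : R => \sum_(q <- [::] : seq (R[i] * int)) q.1 * cexp (q.2 - m) x) =
        (fun x => 0 * cexp 0 x).
      by apply/funext => x; rewrite big_nil mul0r.
    split; first exact: ccontinuous_cexp.
    by rewrite circle_intC_cexp eqxx big_nil.
  have -> : (fun x => \sum_(q <- q :: s) q.1 * cexp (q.2 - m) x) =
      (fun x => q.1 * cexp (q.2 - m) x + \sum_(q <- s) q.1 * cexp (q.2 - m) x).
    by apply/funext => x; rewrite big_cons.
  have cq := ccontinuous_cexp q.1 (q.2 - m).
  split; first exact: (ccontinuousD cq IHc).
  rewrite (circle_intCD cq IHc) IHs circle_intC_cexp subr_eq0 big_cons.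
  by case: (q.2 == m); rewrite ?mulrDr ?add0r.
rewrite mulrA -rmorphM mulVf ?mul1r// lt0r_neq0//; exact: two_pi_gt0.
Qed.

Lemma fourier_real0 (g : R -> R) :
  fourier (fun x => (g x)%:C) 0 = ((2 * pi)^-1 * circle_int g)%:C.
Proof.
rewrite /fourier /circle_intC; under [X in circle_int X]eq_fun do rewrite oppr0 cexp0 mulr1.
under [X in _ +i* circle_int X]eq_fun do rewrite oppr0 cexp0 mulr1.
rewrite /= circle_int_cst mulr0.
by apply/eqP; rewrite eq_complex /= !mul0r !mulr0 subr0 addr0 !eqxx.
Qed.
End circle_integrals.

(** * Complex-valued polynomials and their derivations *)

Section complex_polynomial.
Context (R : realType) (n : nat).
Local Notation E := (phase R n).

Definition cpoly : Type := rpoly R n * rpoly R n.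

Definition ceval (p : cpoly) (c : E) : R[i] := peval p.1 c +i* peval p.2 c.

Definition cconst (z : R[i]) : cpoly := (RConst n (complex.Re z), RConst n (complex.Im z)).
Definition cvar (k : 'I_n) : cpoly := (RVar R (inl k), RVar R (inr k)).
Definition rneg (p : rpoly R n) := RMul (RConst n (-1)) p.
Definition cconj (p : cpoly) : cpoly := (p.1, rneg p.2).
Definition cadd (p q : cpoly) : cpoly := (RAdd p.1 q.1, RAdd p.2 q.2).
Definition cmul (p q : cpoly) : cpoly :=
  (RAdd (RMul p.1 q.1) (rneg (RMul p.2 q.2)), RAdd (RMul p.1 q.2) (RMul p.2 q.1)).

(* This is [d/da_k - i d/db_k = 2 d/dc_k]; the real part of its value on the
   k-th component of a field is the contribution of c_k to the divergence. *)
Definition wirtinger (k : 'I_n) (p : cpoly) : cpoly :=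
  (RAdd (pder (inl k) p.1) (pder (inr k) p.2),
   RAdd (pder (inl k) p.2) (rneg (pder (inr k) p.1))).

Lemma ceval_const z c : ceval (cconst z) c = z.
Proof. by case: z. Qed.

Lemma ceval_conj p c : ceval (cconj p) c = conjc (ceval p c).
Proof. by rewrite /ceval /= mulN1r. Qed.

Lemma ceval_add p q c : ceval (cadd p q) c = ceval p c + ceval q c.
Proof. by []. Qed.

Lemma ceval_mul p q c : ceval (cmul p q) c = ceval p c * ceval q c.
Proof. by apply/eqP; rewrite eq_complex /= mulN1r !eqxx. Qed.

Lemma wirtinger_const k z c : ceval (wirtinger k (cconst z)) c = 0.
Proof. by apply/eqP; rewrite eq_complex /= addr0 mulr0 addr0 eqxx. Qed.

Lemma wirtinger_var k j c : ceval (wirtinger k (cvar j)) c = (2 * (j == k)%:R)%:C.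
Proof.
apply/eqP; rewrite eq_complex /= (inj_eq inl_inj) (inj_eq inr_inj).
by apply/andP; split; apply/eqP => /=; ring.
Qed.

Lemma wirtinger_conj_var k j c : ceval (wirtinger k (cconj (cvar j))) c = 0.
Proof.
apply/eqP; rewrite eq_complex /= (inj_eq inl_inj) (inj_eq inr_inj).
by apply/andP; split; apply/eqP => /=; ring.
Qed.

Lemma wirtinger_add k p q c :
  ceval (wirtinger k (cadd p q)) c = ceval (wirtinger k p) c + ceval (wirtinger k q) c.
Proof. by apply/eqP; rewrite eq_complex /=; apply/andP; split; apply/eqP; ring. Qed.

Lemma wirtinger_mul k p q c : ceval (wirtinger k (cmul p q)) c =
  ceval (wirtinger k p) c * ceval q c + ceval p c * ceval (wirtinger k q) c.
Proof. by apply/eqP; rewrite eq_complex /=; apply/andP; split; apply/eqP; ring. Qed.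

(** The laws hold for values, not for syntax trees. The abstraction lets one Leibniz calculus serve
    both [wirtinger k], for the divergence, and [euler], for gauge invariance. *)
Record derivation (D : cpoly -> cpoly) : Prop := Derivation {
  der_const : forall z c, ceval (D (cconst z)) c = 0;
  der_add : forall p q c, ceval (D (cadd p q)) c = ceval (D p) c + ceval (D q) c;
  der_mul : forall p q c,
    ceval (D (cmul p q)) c = ceval (D p) c * ceval q c + ceval p c * ceval (D q) c }.

Lemma wirtinger_derivation k : derivation (wirtinger k).
Proof.
split=> *; [exact: wirtinger_const|exact: wirtinger_add|exact: wirtinger_mul].
Qed.

(* Multiplies a monomial by twice its degree in the unconjugated variables. *)
Definition euler (p : cpoly) : cpoly :=
  \big[cadd/cconst 0]_k cmul (wirtinger k p) (cvar k).

Lemma ceval_euler p c :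
  ceval (euler p) c = \sum_k ceval (wirtinger k p) c * ceval (cvar k) c.
Proof.
rewrite (big_morph (fun p => ceval p c) (fun p q => ceval_add p q c) (ceval_const 0 c)).
by apply: eq_bigr => k _; rewrite ceval_mul.
Qed.

Lemma euler_derivation : derivation euler.
Proof.
split=> [z c|p q c|p q c]; rewrite !ceval_euler.
- by apply: big1 => k _; rewrite wirtinger_const mul0r.
- by rewrite -big_split; apply: eq_bigr => k _; rewrite wirtinger_add mulrDl.
- rewrite mulr_suml mulr_sumr -big_split; apply: eq_bigr => k _.
  by rewrite wirtinger_mul /=; ring.
Qed.

Lemma euler_var j c : ceval (euler (cvar j)) c = 2 * ceval (cvar j) c.
Proof.
rewrite ceval_euler (bigD1 j)//= wirtinger_var eqxx big1 ?addr0.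
  by congr (_ * _); rewrite mulr1 rmorph_nat.
by move=> k /negbTE kj; rewrite wirtinger_var eq_sym kj mulr0 mul0r.
Qed.

Lemma euler_conj_var j c : ceval (euler (cconj (cvar j))) c = 0.
Proof. by rewrite ceval_euler big1// => k _; rewrite wirtinger_conj_var mul0r. Qed.
End complex_polynomial.
Lemma conjcM (R : realType) (u v : R[i]) : conjc (u * v) = conjc u * conjc v.
Proof. exact: rmorphM. Qed.

Lemma conjc_sum (R : realType) (J : Type) (r : seq J) (P : pred J) (F : J -> R[i]) :
  conjc (\sum_(j <- r | P j) F j) = \sum_(j <- r | P j) conjc (F j).
Proof. exact: rmorph_sum. Qed.

Section laurent.
Context (R : realType) (n : nat).
Local Notation E := (phase R n).

(** A list of coefficient and frequency with no normal form: a product is the list of all pairs, and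
    like frequencies are merged only by [lcoef]. *)
Definition laurent : Type := seq (cpoly R n * int).
Implicit Types l : laurent.

Definition lev l (c : E) (x : R) : R[i] := \sum_(q <- l) ceval q.1 c * cexp q.2 x.

Definition lcoef l (m : int) : cpoly R n :=
  \big[@cadd R n/cconst n 0]_(q <- l | q.2 == m) q.1.

Definition lmul l l' : laurent :=
  [seq (cmul q.1 q'.1, q.2 + q'.2) | q <- l, q' <- l'].

Definition lder (D : cpoly R n -> cpoly R n) l : laurent := [seq (D q.1, q.2) | q <- l].

Lemma lev_mul l l' c x : lev (lmul l l') c x = lev l c x * lev l' c x.
Proof.
rewrite /lev /lmul big_allpairs_dep /= mulr_suml; apply: eq_bigr => q _.
rewrite mulr_sumr; apply: eq_bigr => q' _.
by rewrite ceval_mul cexpD; ring.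
Qed.

Lemma ceval_lcoef l m c : ceval (lcoef l m) c = \sum_(q <- l | q.2 == m) ceval q.1 c.
Proof.
exact: (big_morph (fun p => ceval p c) (fun p q => ceval_add p q c) (ceval_const 0 c)).
Qed.

Lemma fourier_lev l c m : fourier (lev l c) m = ceval (lcoef l m) c.
Proof.
have -> : lev l c = fun x : R => \sum_(q <- [seq (ceval q.1 c, q.2) | q <- l]) q.1 * cexp q.2 x.
  by apply/funext => x; rewrite big_map.
by rewrite fourier_trig big_map ceval_lcoef.
Qed.

Lemma lev_scale (z : R[i]) l c x :
  lev [seq (cmul (cconst n z) q.1, q.2) | q <- l] c x = z * lev l c x.
Proof.
rewrite /lev big_map mulr_sumr; apply: eq_bigr => q _.
by rewrite ceval_mul ceval_const mulrA.
Qed.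

Lemma lev_cat l l' c x : lev (l ++ l') c x = lev l c x + lev l' c x.
Proof. by rewrite /lev big_cat. Qed.

Section derivation.
Variable D : cpoly R n -> cpoly R n.
Hypothesis derD : derivation D.

(** Derivations in the phase variables act on coefficients and leave $e^{imx}$ alone, so they
    commute with Fourier coefficients. Divergence terms thereby become integrals over the circle. *)
Lemma der_lcoef l m c : ceval (D (lcoef l m)) c = fourier (lev (lder D l) c) m.
Proof.
rewrite fourier_lev ceval_lcoef /lder big_map /=.
exact: (big_morph (fun p => ceval (D p) c) (fun p q => der_add derD p q c) (der_const derD 0 c)).
Qed.

Lemma lder_mul l l' c x : lev (lder D (lmul l l')) c x =
  lev (lder D l) c x * lev l' c x + lev l c x * lev (lder D l') c x.
Proof.
rewrite /lev /lder /lmul big_map big_allpairs_dep /= !big_map !mulr_suml -big_split.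
apply: eq_bigr => q _; rewrite /= !mulr_sumr -big_split; apply: eq_bigr => q' _.
by rewrite /= der_mul// cexpD; ring.
Qed.

Lemma lder_scale (z : R[i]) l c x :
  lev (lder D [seq (cmul (cconst n z) q.1, q.2) | q <- l]) c x = z * lev (lder D l) c x.
Proof.
rewrite /lev /lder !big_map mulr_sumr; apply: eq_bigr => q _ /=.
by rewrite der_mul// der_const// ceval_const mul0r add0r mulrA.
Qed.

Lemma lder_cat l l' c x :
  lev (lder D (l ++ l')) c x = lev (lder D l) c x + lev (lder D l') c x.
Proof. by rewrite /lder map_cat lev_cat. Qed.
End derivation.
End laurent.

(** * The truncated equation as a polynomial field *)

Section schroedinger_field.
Context (R : realType) (N : nat).
Local Notation n := (2 * N).+1.
Local Notation E := (phase R n).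
Local Notation I := ('I_n + 'I_n)%type.

Lemma mode_inj : injective (@mode N).
Proof. by move=> j k; rewrite /mode => /addIr [] /val_inj. Qed.

(** The Fourier symbol $ij$ of $\partial_x$; its square is the symbol of $\partial_x^2$. *)
Definition imode (j : 'I_n) : R[i] := 0 +i* (mode j)%:~R.

Definition Lv : laurent R n := [seq (cvar R j, mode j) | j <- index_enum 'I_n].
Definition Lvx : laurent R n :=
  [seq (cmul (cconst n (imode j)) (cvar R j), mode j) | j <- index_enum 'I_n].
Definition Lvbar : laurent R n := [seq (cconj (cvar R j), - mode j) | j <- index_enum 'I_n].
Definition Lvxbar : laurent R n :=
  [seq (cmul (cconst n (conjc (imode j))) (cconj (cvar R j)), - mode j) | j <- index_enum 'I_n].

Definition Labs2 := lmul Lv Lvbar.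
Definition Labs4 := lmul Labs2 Labs2.
Definition Lcubic := lmul Labs2 Lv.
Definition Lquintic := lmul Labs4 Lv.
Definition Lderiv := lmul (lmul Lv Lv) Lvxbar.

Lemma ceval_cvar j (c : E) : ceval (cvar R j) c = coef c j.
Proof. by []. Qed.

Lemma lev_v (c : E) x : lev Lv c x = trigpoly c x.
Proof. by rewrite /lev /Lv big_map. Qed.

Lemma lev_vbar (c : E) x : lev Lvbar c x = conjc (trigpoly c x).
Proof.
rewrite /lev /Lvbar big_map /trigpoly conjc_sum; apply: eq_bigr => j _.
by cbv beta; rewrite conjcM -cexpN -ceval_cvar -ceval_conj.
Qed.

Lemma lev_vxbar (c : E) x : lev Lvxbar c x = conjc (lev Lvx c x).
Proof.
rewrite /lev /Lvxbar /Lvx !big_map conjc_sum; apply: eq_bigr => j _.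
by cbv beta; rewrite conjcM -cexpN !ceval_mul conjcM !ceval_const -ceval_conj.
Qed.

Lemma is_derive_cexp (z : R[i]) (m : int) (x : R) :
  is_derive x 1 (fun y : R => complex.Re (z * cexp m y))
    (complex.Re ((0 +i* m%:~R) * z * cexp m x)) /\
  is_derive x 1 (fun y : R => complex.Im (z * cexp m y))
    (complex.Im ((0 +i* m%:~R) * z * cexp m x)).
Proof.
case: z => a b /=.
have dc := is_derive_cosM (m%:~R : R) x; have ds := is_derive_sinM (m%:~R : R) x.
split.
  apply: (is_derive_eq (is_deriveB (is_deriveZ a dc) (is_deriveZ b ds))).
  by rewrite /GRing.scale/=; ring.
apply: (is_derive_eq (is_deriveD (is_deriveZ a ds) (is_deriveZ b dc))).
by rewrite /GRing.scale/=; ring.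
Qed.

Lemma is_derive_trig (s : seq (R[i] * int)) (x : R) :
  is_derive x 1 (fun y : R => complex.Re (\sum_(q <- s) q.1 * cexp q.2 y))
    (complex.Re (\sum_(q <- s) (0 +i* q.2%:~R) * q.1 * cexp q.2 x)) /\
  is_derive x 1 (fun y : R => complex.Im (\sum_(q <- s) q.1 * cexp q.2 y))
    (complex.Im (\sum_(q <- s) (0 +i* q.2%:~R) * q.1 * cexp q.2 x)).
Proof.
have ReD (u v : R[i]) : complex.Re (u + v) = complex.Re u + complex.Re v.
  by case: u v => [? ?] [].
have ImD (u v : R[i]) : complex.Im (u + v) = complex.Im u + complex.Im v.
  by case: u v => [? ?] [].
elim: s => [|q s [IHr IHi]].
  rewrite !big_nil; split.
    by under eq_fun do rewrite big_nil; exact: is_derive_cst.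
  by under eq_fun do rewrite big_nil; exact: is_derive_cst.
have [hr hi] := is_derive_cexp q.1 q.2 x.
rewrite !big_cons ReD ImD; split.
  by under eq_fun do rewrite big_cons ReD; exact: is_deriveD.
by under eq_fun do rewrite big_cons ImD; exact: is_deriveD.
Qed.

Lemma dx_trig (s : seq (R[i] * int)) :
  dx (fun x : R => \sum_(q <- s) q.1 * cexp q.2 x) =
  (fun x : R => \sum_(q <- s) (0 +i* q.2%:~R) * q.1 * cexp q.2 x).
Proof.
apply/funext => x; rewrite /dx !derive1E.
have [hr hi] := is_derive_trig s x.
rewrite (@derive_val _ _ _ _ _ _ _ hr) (@derive_val _ _ _ _ _ _ _ hi).
by case: (\sum_(q <- s) _).
Qed.

Lemma trigpoly_seq c :
  trigpoly c = fun x : R =>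
    \sum_(q <- [seq (coef c j, mode j) | j <- index_enum 'I_n]) q.1 * cexp q.2 x.
Proof. by apply/funext => x; rewrite big_map. Qed.

Lemma dx_trigpoly (c : E) : dx (trigpoly c) = lev Lvx c.
Proof.
rewrite trigpoly_seq dx_trig; apply/funext => x.
rewrite /lev /Lvx !big_map; apply: eq_bigr => j _ /=.
by rewrite ceval_mul ceval_const.
Qed.

Lemma dxx_trigpoly (c : E) :
  dx (dx (trigpoly c)) = fun x : R => \sum_j imode j * (imode j * coef c j) * cexp (mode j) x.
Proof.
rewrite trigpoly_seq dx_trig.
have -> : (fun x : R => \sum_(q <- [seq (coef c j, mode j) | j <- index_enum 'I_n])
    (0 +i* q.2%:~R) * q.1 * cexp q.2 x) =
  (fun x : R => \sum_(q <- [seq (imode j * coef c j, mode j) | j <- index_enum 'I_n])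
    q.1 * cexp q.2 x).
  by apply/funext => x; rewrite !big_map.
by rewrite dx_trig; apply/funext => x; rewrite big_map.
Qed.

Lemma normc_sqr (z : R[i]) : (normc z ^+ 2)%:C = z * conjc z.
Proof.
case: z => a b; rewrite /normc sqr_sqrtr ?addr_ge0 ?sqr_ge0//.
by apply/eqP; rewrite eq_complex /=; apply/andP; split; apply/eqP; ring.
Qed.

Lemma normc_pow4 (z : R[i]) : (normc z ^+ 4)%:C = (z * conjc z) ^+ 2.
Proof. by rewrite -normc_sqr -rmorphXn -exprM. Qed.

Lemma lev_abs2 (c : E) x : lev Labs2 c x = (normc (trigpoly c x) ^+ 2)%:C.
Proof. by rewrite lev_mul lev_v lev_vbar normc_sqr. Qed.

Lemma lev_abs4 (c : E) x : lev Labs4 c x = (normc (trigpoly c x) ^+ 4)%:C.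
Proof. by rewrite lev_mul !lev_abs2 normc_sqr normc_pow4 expr2. Qed.

Lemma lev_cubic (c : E) x : lev Lcubic c x = (normc (trigpoly c x) ^+ 2)%:C * trigpoly c x.
Proof. by rewrite lev_mul lev_abs2 lev_v. Qed.

Lemma lev_quintic (c : E) x : lev Lquintic c x = (normc (trigpoly c x) ^+ 4)%:C * trigpoly c x.
Proof. by rewrite lev_mul lev_abs4 lev_v. Qed.

Lemma lev_deriv (c : E) x : lev Lderiv c x = trigpoly c x ^+ 2 * conjc (dx (trigpoly c) x).
Proof. by rewrite !lev_mul lev_v lev_vxbar dx_trigpoly. Qed.

Lemma ceval_lcoef_real (l : laurent R n) (c : E) (g : R -> R) : (forall x, lev l c x = (g x)%:C) ->
  ceval (lcoef l 0) c = ((2 * pi)^-1 * circle_int g)%:C.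
Proof.
move=> lg; rewrite -fourier_lev -fourier_real0.
by have -> : lev l c = (fun x => (g x)%:C) by exact/funext.
Qed.

(* [v conj(v_x) - conj(v) v_x = 2 i Im(v conj(v_x))] *)
Definition Limag : laurent R n :=
  [seq (cmul (cconst n (0 +i* - 2^-1)) q.1, q.2) | q <- lmul Lv Lvxbar] ++
  [seq (cmul (cconst n (0 +i* 2^-1)) q.1, q.2) | q <- lmul Lvbar Lvx].

Lemma lev_imag (c : E) x :
  lev Limag c x = (complex.Im (trigpoly c x * conjc (dx (trigpoly c) x)))%:C.
Proof.
rewrite dx_trigpoly lev_cat !lev_scale !lev_mul lev_v lev_vbar lev_vxbar.
case: (trigpoly c x) (lev Lvx c x) => [a b] [a' b'].
by apply/eqP; rewrite eq_complex /=; apply/andP; split; apply/eqP; field.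
Qed.

Definition massP : cpoly R n := lcoef Labs2 0.

(** A zeroth coefficient carries the factor $1/(2\pi)$, so the weights $-2$ and $1/2$ give the
    $-1/\pi$ and $1/(4\pi)$ of [psi]. *)
Definition psiP : cpoly R n :=
  cadd (cmul (cconst n (-2)) (lcoef Limag 0))
    (cadd (cmul (cconst n 2^-1) (lcoef Labs4 0))
          (cmul (cconst n (-1)) (cmul massP massP))).

Lemma ceval_massP (c : E) : ceval massP c = (mass (trigpoly c))%:C.
Proof. by apply: ceval_lcoef_real => x; exact: lev_abs2. Qed.

Lemma ceval_psiP (c : E) : ceval psiP c = (psi (trigpoly c))%:C.
Proof.
rewrite /psiP !ceval_add !ceval_mul !ceval_const ceval_massP.
rewrite (ceval_lcoef_real (lev_imag c)) (ceval_lcoef_real (lev_abs4 c)) /psi.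
have pi0 : pi != 0 :> R by rewrite lt0r_neq0// pi_gt0.
set u := circle_int _; set w := circle_int _; set m := mass _.
have -> : -2 = (-2)%:C :> R[i] by rewrite rmorphN rmorph_nat.
have -> : 2^-1 = (2^-1)%:C :> R[i] by rewrite fmorphV rmorph_nat.
have -> : -1 = (-1)%:C :> R[i] by rewrite rmorphN rmorph1.
rewrite -!rmorphM -!rmorphD; congr (_%:C).
by move: u w m (pi : R) pi0 => u w m p p0; field.
Qed.

Definition fieldP (k : 'I_n) : cpoly R n :=
  cadd (cmul (cconst n ('i%C * imode k ^+ 2)) (cvar R k))
  (cadd (cmul (cconst n (-1)) (lcoef Lderiv (mode k)))
  (cadd (cmul (cconst n ('i%C / 2)) (lcoef Lquintic (mode k)))
  (cadd (cmul (cconst n (- 'i%C)) (cmul psiP (cvar R k)))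
        (cmul (cconst n (- 'i%C)) (cmul massP (lcoef Lcubic (mode k))))))).

(** Every term of [rhs] is a sum over the modes of the window, the projected ones by the definition
    of [PN]. Since [mode] is injective, the coefficient at [mode k] picks exactly the summand
    [k]. *)
Lemma ode_fieldE (c : E) k : ode_field c k = ceval (fieldP k) c.
Proof.
rewrite /ode_field.
have -> : rhs N (trigpoly c) = fun x : R =>
    \sum_(q <- [seq (ceval (fieldP j) c, mode j) | j <- index_enum 'I_n]) q.1 * cexp q.2 x.
  apply/funext => x; rewrite big_map /rhs /PN.
  have -> : (fun y : R => trigpoly c y ^+ 2 * conjc (dx (trigpoly c) y)) = lev Lderiv c.
    by apply/funext => y; rewrite lev_deriv.
  have -> : (fun y : R => (normc (trigpoly c y) ^+ 4)%:C * trigpoly c y) = lev Lquintic c.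
    by apply/funext => y; rewrite lev_quintic.
  have -> : (fun y : R => (normc (trigpoly c y) ^+ 2)%:C * trigpoly c y) = lev Lcubic c.
    by apply/funext => y; rewrite lev_cubic.
  rewrite dxx_trigpoly {2}/trigpoly !mulr_sumr -!sumrB -big_split /= -!sumrB.
  apply: eq_bigr => j _; rewrite /fieldP !ceval_add !ceval_mul !ceval_const !fourier_lev.
  rewrite ceval_psiP ceval_massP ceval_cvar; ring.
rewrite fourier_trig big_map (eq_bigl (pred1 k)) ?big_pred1_eq// => j.
by rewrite /= (inj_eq mode_inj).
Qed.
End schroedinger_field.
(** * Divergence and mass conservation of the truncated equation *)

Section reality.
Context (R : realType).

Lemma ReD (u v : R[i]) : complex.Re (u + v) = complex.Re u + complex.Re v.
Proof. by case: u v => [? ?] []. Qed.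

Lemma Re_iM (z : R[i]) : z \is Num.real -> complex.Re ('i%C * z) = 0.
Proof. by move=> /complex_realP[r ->] /=; ring. Qed.

Lemma real_complexM (r s : R) : (r * s)%:C = r%:C * s%:C.
Proof. exact: rmorphM. Qed.

Lemma natrM_complex (m : nat) (r : R) : (m%:R * r)%:C = m%:R * r%:C.
Proof. by rewrite -[m%:R in RHS](rmorph_nat (real_complex R)) -rmorphM. Qed.

Lemma real_complexR (r : R) : r%:C \is Num.real.
Proof. by apply/complex_realP; exists r. Qed.

Lemma conjM_real (z : R[i]) : conjc z * z \is Num.real.
Proof. by rewrite mulrC -normc_sqr real_complexR. Qed.
End reality.

Section schroedinger_liouville.
Context (R : realType) (N : nat).
Local Notation n := (2 * N).+1.
Local Notation E := (phase R n).
Local Notation I := ('I_n + 'I_n)%type.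
Implicit Types (c : E) (l : laurent R n).
Local Notation v := (@trigpoly R N).
Local Notation vx c := (lev (Lvx R N) c).

Lemma eq_fourier (f g : R -> R[i]) m : f =1 g -> fourier f m = fourier g m.
Proof. by move=> fg; have -> : f = g by exact/funext. Qed.

(** Differentiating $v$ in $c_k$ produces $e^{ikx}$, and the diagonal of the divergence reads the
    [k]-th coefficient: the two cancel and leave a mean. *)
Lemma fourier_shift (f : R -> R[i]) m : fourier (fun x => f x * cexp m x) m = fourier f 0.
Proof.
rewrite /fourier; congr (_ * circle_intC _); apply/funext => x.
by rewrite -mulrA cexpNK oppr0 cexp0.
Qed.

Lemma fourier_real (g : R -> R) : fourier (fun x => (g x)%:C) 0 \is Num.real.
Proof. by rewrite fourier_real0 real_complexR. Qed.

Lemma lder_wirtinger_v k c x :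
  lev (lder (wirtinger k) (Lv R N)) c x = 2 * cexp (mode k) x.
Proof.
rewrite /lev /lder /Lv !big_map (bigD1 k)//= wirtinger_var eqxx big1 ?addr0.
  by rewrite mulr1 rmorph_nat.
by move=> j /negbTE jk; rewrite wirtinger_var jk mulr0 mul0r.
Qed.

Lemma lder_wirtinger_vbar k c x : lev (lder (wirtinger k) (Lvbar R N)) c x = 0.
Proof.
rewrite /lev /lder /Lvbar !big_map big1// => j _ /=.
by rewrite wirtinger_conj_var mul0r.
Qed.

Lemma lder_wirtinger_vxbar k c x : lev (lder (wirtinger k) (Lvxbar R N)) c x = 0.
Proof.
rewrite /lev /lder /Lvxbar !big_map big1// => j _ /=.
by rewrite wirtinger_mul wirtinger_conj_var wirtinger_const mul0r mulr0 addr0 mul0r.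
Qed.

Lemma lder_euler_v c x : lev (lder (@euler R n) (Lv R N)) c x = 2 * v c x.
Proof.
rewrite /lev /lder /Lv !big_map mulr_sumr; apply: eq_bigr => j _ /=.
by rewrite euler_var mulrA.
Qed.

Lemma lder_euler_vx c x : lev (lder (@euler R n) (Lvx R N)) c x = 2 * vx c x.
Proof.
rewrite /lev /lder /Lvx !big_map mulr_sumr; apply: eq_bigr => j _ /=.
rewrite (der_mul (euler_derivation R n)) euler_var (der_const (euler_derivation R n)).
by rewrite ceval_mul; ring.
Qed.

Lemma lder_euler_vbar c x : lev (lder (@euler R n) (Lvbar R N)) c x = 0.
Proof.
rewrite /lev /lder /Lvbar !big_map big1// => j _ /=.
by rewrite euler_conj_var mul0r.
Qed.

Lemma lder_euler_vxbar c x : lev (lder (@euler R n) (Lvxbar R N)) c x = 0.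
Proof.
rewrite /lev /lder /Lvxbar !big_map big1// => j _ /=.
rewrite (der_mul (euler_derivation R n)) euler_conj_var (der_const (euler_derivation R n)).
by rewrite mul0r mulr0 addr0 mul0r.
Qed.

Lemma euler_massP_real c : ceval (euler (massP R N)) c \is Num.real.
Proof.
have dE := euler_derivation R n.
rewrite (der_lcoef dE) (@eq_fourier _ (fun x => (2 * normc (v c x) ^+ 2)%:C)) ?fourier_real// => x.
rewrite (lder_mul dE) lder_euler_v lder_euler_vbar lev_vbar mulr0 addr0.
by rewrite -mulrA -normc_sqr natrM_complex.
Qed.

(* [psi] is gauge invariant, hence annihilated by the imaginary part of the
   Euler operator. *)
Lemma euler_psiP_real c : ceval (euler (psiP R N)) c \is Num.real.
Proof.
have dE := euler_derivation R n.
rewrite /psiP !(der_add dE) !(der_mul dE) !(der_const dE) !mul0r !add0r !ceval_const.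
have h2 : (2 : R[i]) \is Num.real by exact: realn.
have hM : ceval (massP R N) c \is Num.real by rewrite ceval_massP real_complexR.
have hS : ceval (euler (lcoef (Limag R N) 0)) c \is Num.real.
  rewrite (der_lcoef dE) (@eq_fourier _
    (fun x => (2 * complex.Im (v c x * conjc (dx (v c) x)))%:C)) ?fourier_real// => x.
  rewrite natrM_complex -lev_imag lev_cat (lder_cat (@euler R n)) !(lder_scale dE) !lev_scale.
  rewrite !(lder_mul dE) !lev_mul lder_euler_v lder_euler_vx lder_euler_vbar lder_euler_vxbar.
  by rewrite lev_v; ring.
have hT : ceval (euler (lcoef (Labs4 R N) 0)) c \is Num.real.
  rewrite (der_lcoef dE) (@eq_fourier _
    (fun x => (4 * normc (v c x) ^+ 4)%:C)) ?fourier_real// => x.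
  rewrite natrM_complex -lev_abs4 /Labs4 !(lder_mul dE) lder_euler_v lder_euler_vbar.
  by rewrite !lev_mul lev_v; ring.
have hE := euler_massP_real c.
apply: rpredD; first by apply: rpredM => //; rewrite rpredN.
apply: rpredD; first by apply: rpredM => //; rewrite rpredV.
apply: rpredM; first by rewrite rpredN rpred1.
by apply: rpredD; apply: rpredM.
Qed.

(** Pairing with $\overline v$, whose frequencies lie in the window, does not see what the
    projection discards. *)
Lemma sum_conj_lcoef l c :
  \sum_k conjc (coef c k) * ceval (lcoef l (mode k)) c =
  ceval (lcoef (lmul l (Lvbar R N)) 0) c.
Proof.
rewrite ceval_lcoef /lmul [RHS]big_mkcond [RHS]big_allpairs_dep /=.
under [RHS]eq_bigr do rewrite /Lvbar big_map.
rewrite exchange_big /=; apply: eq_bigr => k _.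
rewrite ceval_lcoef mulr_sumr big_mkcond; apply: eq_bigr => q _.
rewrite subr_eq0; case: eqP => // _.
by rewrite ceval_mul ceval_conj mulrC.
Qed.

(** Primitives $|v|^2/2$ and $|v|^4/4$ for the two real parts left by the derivative nonlinearity:
    the first arises in the divergence, the second in mass conservation. *)
Lemma is_derive_abs2_abs4 c (x : R) :
  let a y := complex.Re (v c y) in let b y := complex.Im (v c y) in
  let w y := complex.Re (v c y * conjc (vx c y)) in
  is_derive x 1 (fun y => 2^-1 * (a y * a y + b y * b y)) (w x) /\
  is_derive x 1 (fun y => 4^-1 * ((a y * a y + b y * b y) * (a y * a y + b y * b y)))
    ((a x * a x + b x * b x) * w x).
Proof.
move=> a b w.
have [da db] : is_derive x 1 a (complex.Re (vx c x)) /\ is_derive x 1 b (complex.Im (vx c x)).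
  have := is_derive_trig [seq (coef c j, mode j) | j <- index_enum 'I_n] x.
  have -> : \sum_(q <- [seq (coef c j, mode j) | j <- index_enum 'I_n])
      (0 +i* q.2%:~R) * q.1 * cexp q.2 x = vx c x.
    by rewrite /lev /Lvx !big_map; apply: eq_bigr => j _; rewrite /= ceval_mul ceval_const.
  by rewrite /a /b trigpoly_seq.
have ds := is_deriveD (is_deriveM da da) (is_deriveM db db).
have wE : w x = a x * complex.Re (vx c x) + b x * complex.Im (vx c x).
  by rewrite /w /a /b; case: (v c x) (vx c x) => [a1 b1] [a2 b2] /=; ring.
split.
  apply: (is_derive_eq (is_deriveZ 2^-1 ds)).
  by rewrite wE /GRing.scale/=; field.
apply: (is_derive_eq (is_deriveZ 4^-1 (is_deriveM ds ds))).
by rewrite wE /GRing.scale/= !fctE; field.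
Qed.

Lemma Re_fourier0 (f : R -> R[i]) :
  complex.Re (fourier f 0) = (2 * pi)^-1 * circle_int (fun x => complex.Re (f x)).
Proof.
rewrite /fourier /circle_intC /= mul0r subr0; congr (_ * circle_int _).
by apply/funext => x; rewrite oppr0 cexp0 mulr1.
Qed.

Lemma continuous_Re_lev l c : continuous (fun x => complex.Re (lev l c x)).
Proof.
move=> x; have [h _] := is_derive_trig [seq (ceval q.1 c, q.2) | q <- l] x.
have -> : (fun x => complex.Re (lev l c x)) =
    (fun y => complex.Re (\sum_(q <- [seq (ceval q.1 c, q.2) | q <- l]) q.1 * cexp q.2 y)).
  by apply/funext => y; rewrite big_map.
exact: is_derive_continuous h.
Qed.

Lemma trigpoly_2pi c : v c (2 * pi) = v c 0.
Proof.
apply: eq_bigr => j _; rewrite cexp_2pi; congr (_ * _).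
by rewrite /cexp mulr0 cos0 sin0.
Qed.

Lemma Re_fourier_vvx c : complex.Re (fourier (lev (lmul (Lv R N) (Lvxbar R N)) c) 0) = 0.
Proof.
rewrite Re_fourier0.
have levE : (fun x => complex.Re (lev (lmul (Lv R N) (Lvxbar R N)) c x)) =
    (fun x => complex.Re (v c x * conjc (vx c x))).
  by apply/funext => x; rewrite lev_mul lev_v lev_vxbar.
have -> : circle_int (fun x => complex.Re (lev (lmul (Lv R N) (Lvxbar R N)) c x)) = 0.
  rewrite levE; apply: (circle_int_derive (fun x => (is_derive_abs2_abs4 c x).1)).
    by rewrite -levE; exact: continuous_Re_lev.
  by rewrite trigpoly_2pi.
by rewrite mulr0.
Qed.

Lemma Re_fourier_v3vx c : complex.Re (fourier (lev (lmul (Lderiv R N) (Lvbar R N)) c) 0) = 0.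
Proof.
have levE x : complex.Re (lev (lmul (Lderiv R N) (Lvbar R N)) c x) =
    (complex.Re (v c x) * complex.Re (v c x) + complex.Im (v c x) * complex.Im (v c x)) *
    complex.Re (v c x * conjc (vx c x)).
  rewrite !lev_mul lev_v lev_vxbar lev_vbar.
  by case: (v c x) (vx c x) => [a1 b1] [a2 b2] /=; ring.
rewrite Re_fourier0.
have vvx : circle_int (fun x => complex.Re (lev (lmul (Lderiv R N) (Lvbar R N)) c x)) = 0.
  have levE' : (fun x => complex.Re (lev (lmul (Lderiv R N) (Lvbar R N)) c x)) = _ :=
    funext levE.
  rewrite levE'; apply: (circle_int_derive (fun x => (is_derive_abs2_abs4 c x).2)).
    by rewrite -levE'; exact: continuous_Re_lev.
  by rewrite trigpoly_2pi.
by rewrite vvx mulr0.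
Qed.

Lemma fourier_abs4_real c : ceval (lcoef (Labs4 R N) 0) c \is Num.real.
Proof. by rewrite (ceval_lcoef_real (lev_abs4 c)) real_complexR. Qed.

Lemma cubic_vbar_real c : ceval (lcoef (lmul (Lcubic R N) (Lvbar R N)) 0) c \is Num.real.
Proof.
rewrite (@ceval_lcoef_real _ _ _ c
  (fun x => normc (v c x) ^+ 2 * normc (v c x) ^+ 2)) ?real_complexR//.
by move=> x; rewrite lev_mul lev_cubic lev_vbar [RHS]real_complexM !normc_sqr mulrA.
Qed.

Lemma imode_sqr_real (j : 'I_n) : imode R j ^+ 2 \is Num.real.
Proof.
rewrite (_ : imode R j ^+ 2 = (- (mode j)%:~R ^+ 2)%:C) ?real_complexR//.
by apply/eqP; rewrite eq_complex /=; apply/andP; split; apply/eqP; ring.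
Qed.

Lemma sum_Re (J : Type) (r : seq J) (F : J -> R[i]) :
  \sum_(j <- r) complex.Re (F j) = complex.Re (\sum_(j <- r) F j).
Proof. by elim/big_rec2: _ => // j y _ _ ->; rewrite ReD. Qed.

Lemma ceval_fieldP k c : ceval (fieldP R k) c =
  'i%C * (imode R k ^+ 2 * coef c k + 2^-1 * ceval (lcoef (Lquintic R N) (mode k)) c
    - ceval (psiP R N) c * coef c k
    - ceval (massP R N) c * ceval (lcoef (Lcubic R N) (mode k)) c)
  - ceval (lcoef (Lderiv R N) (mode k)) c.
Proof.
rewrite /fieldP; move: (psiP R N) (massP R N) => p m.
by rewrite !ceval_add !ceval_mul !ceval_const ceval_cvar; ring.
Qed.

Lemma field_conserves_mass c :
  \sum_k complex.Re (conjc (coef c k) * ceval (fieldP R k) c) = 0.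
Proof.
rewrite sum_Re.
(* All terms inside the bracket after ['i%C] are real; the derivative nonlinearity stands apart as
   the mean of $|v|^2v\overline{v_x}$. *)
have -> : \sum_k conjc (coef c k) * ceval (fieldP R k) c =
   'i%C * (\sum_k imode R k ^+ 2 * (conjc (coef c k) * coef c k)
     + 2^-1 * \sum_k conjc (coef c k) * ceval (lcoef (Lquintic R N) (mode k)) c
     - ceval (psiP R N) c * \sum_k conjc (coef c k) * coef c k
     - ceval (massP R N) c * \sum_k conjc (coef c k) * ceval (lcoef (Lcubic R N) (mode k)) c)
   + (- \sum_k conjc (coef c k) * ceval (lcoef (Lderiv R N) (mode k)) c).
  move: (ceval_fieldP ^~ c) => fE.
  rewrite !mulrDr !mulrN !mulr_sumr -!sumrN -!big_split; apply: eq_bigr => k _; cbv beta.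
  rewrite fE; move: (ceval (psiP R N) c) (conjc (coef c k)) => p z /=; ring.
rewrite ReD !sum_conj_lcoef.
have -> : complex.Re (- ceval (lcoef (lmul (Lderiv R N) (Lvbar R N)) 0) c) = 0.
  have := Re_fourier_v3vx c; rewrite fourier_lev.
  by case: (ceval _ _) => a b /= ->; rewrite oppr0.
rewrite addr0 Re_iM//.
have h6 : ceval (lcoef (lmul (Lquintic R N) (Lvbar R N)) 0) c \is Num.real.
  rewrite (@ceval_lcoef_real _ _ _ c
    (fun x => normc (v c x) ^+ 4 * normc (v c x) ^+ 2)) ?real_complexR//.
  by move=> x; rewrite lev_mul lev_quintic lev_vbar [RHS]real_complexM normc_sqr mulrA.
have h4 := cubic_vbar_real c.
rewrite ceval_psiP ceval_massP; apply: rpredB; last by apply: rpredM => //; exact: real_complexR.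
apply: rpredB.
  apply: rpredD; last by apply: rpredM => //; rewrite rpredV; exact: realn.
  by apply: rpred_sum => k _; apply: rpredM; [exact: imode_sqr_real|exact: conjM_real].
apply: rpredM; first exact: real_complexR.
by apply: rpred_sum => k _; exact: conjM_real.
Qed.

Lemma fourier_scale (z : R[i]) l c m :
  fourier (fun x => z * lev l c x) m = z * fourier (lev l c) m.
Proof.
rewrite -(@eq_fourier (lev [seq (cmul (cconst n z) q.1, q.2) | q <- l] c)); last first.
  by move=> x; rewrite lev_scale.
rewrite !fourier_lev !ceval_lcoef big_map mulr_sumr; apply: eq_bigr => q _.
by rewrite ceval_mul ceval_const.
Qed.

Lemma wirtinger_deriv k c : ceval (wirtinger k (lcoef (Lderiv R N) (mode k))) c =
  4 * fourier (lev (lmul (Lv R N) (Lvxbar R N)) c) 0.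
Proof.
have dW := wirtinger_derivation R k.
rewrite (der_lcoef dW) -fourier_scale -[RHS](fourier_shift _ (mode k)).
apply: eq_fourier => x; rewrite !(lder_mul dW) lder_wirtinger_v lder_wirtinger_vxbar.
by rewrite !lev_mul; ring.
Qed.
(** [wirtinger k] is twice the derivative in $c_k$ and ignores $\overline v$, whence 6 from
    $v^3\overline v^2$ and 4 from $v^2\overline v$ and $v^2\overline{v_x}$. The product rule on
    [psiP] and [massP] adds the nonlocal terms. *)
Lemma wirtinger_fieldP k c : ceval (wirtinger k (fieldP R k)) c =
  'i%C * (2 * imode R k ^+ 2 + 2^-1 * (6 * ceval (lcoef (Labs4 R N) 0) c)
    - (ceval (wirtinger k (psiP R N)) c * ceval (cvar R k) c + 2 * ceval (psiP R N) c)
    - (2 * (conjc (coef c k) * ceval (lcoef (Lcubic R N) (mode k)) c)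
       + 4 * (ceval (massP R N) c * ceval (massP R N) c)))
  - 4 * ceval (lcoef (lmul (Lv R N) (Lvxbar R N)) 0) c.
Proof.
have dW := wirtinger_derivation R k.
have wk : ceval (wirtinger k (cvar R k)) c = 2.
  by rewrite wirtinger_var eqxx mulr1 rmorph_nat.
have w5 : ceval (wirtinger k (lcoef (Lquintic R N) (mode k))) c =
    6 * ceval (lcoef (Labs4 R N) 0) c.
  rewrite (der_lcoef dW) -fourier_lev -fourier_scale -[RHS](fourier_shift _ (mode k)).
  apply: eq_fourier => x; rewrite !(lder_mul dW) lder_wirtinger_v lder_wirtinger_vbar.
  by rewrite !lev_mul; ring.
have w3 : ceval (wirtinger k (lcoef (Lcubic R N) (mode k))) c = 4 * ceval (massP R N) c.
  rewrite (der_lcoef dW) -fourier_lev -fourier_scale -[RHS](fourier_shift _ (mode k)).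
  apply: eq_fourier => x; rewrite !(lder_mul dW) lder_wirtinger_v lder_wirtinger_vbar.
  by rewrite !lev_mul; ring.
have wM : ceval (wirtinger k (massP R N)) c = 2 * conjc (coef c k).
  rewrite (der_lcoef dW) (@eq_fourier _ (lev [seq (cmul (cconst n 2) (cconj (cvar R j)),
      mode k - mode j) | j <- index_enum 'I_n] c)); last first.
    move=> x; rewrite !(lder_mul dW) lder_wirtinger_v lder_wirtinger_vbar mulr0 addr0.
    rewrite /lev /Lvbar !big_map mulr_sumr; apply: eq_bigr => j _ /=.
    by rewrite ceval_mul ceval_const cexpD; ring.
  rewrite fourier_lev ceval_lcoef big_map (eq_bigl (pred1 k)); last first.
    by move=> j; rewrite /= subr_eq0 (inj_eq (@mode_inj N)) eq_sym.
  by rewrite big_pred1_eq ceval_mul ceval_const ceval_conj.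
rewrite /fieldP; move: (psiP R N) => p.
move: (wirtinger_deriv k c) wM w3; move: (massP R N) => m wd wM w3.
rewrite !(der_add dW) !(der_mul dW) !(der_const dW) !ceval_const !ceval_mul ?ceval_const.
rewrite wk w5 w3 wM wd fourier_lev; ring.
Qed.

Lemma field_divergence_free c : \sum_k complex.Re (ceval (wirtinger k (fieldP R k)) c) = 0.
Proof.
rewrite sum_Re.
(* Summation over [k] assembles the nonlocal terms: derivatives of [psiP] times $c_k$ form [euler],
   real by gauge invariance, and those of [massP] pair the cubic term with $\overline v$, giving the
   mean of $|v|^4$. *)
have -> : \sum_k ceval (wirtinger k (fieldP R k)) c =
  'i%C * (\sum_(k < n) (2 * imode R k ^+ 2 + 2^-1 * (6 * ceval (lcoef (Labs4 R N) 0) c))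
    - (ceval (euler (psiP R N)) c + \sum_(k < n) 2 * ceval (psiP R N) c)
    - (2 * ceval (lcoef (lmul (Lcubic R N) (Lvbar R N)) 0) c
       + \sum_(k < n) 4 * (ceval (massP R N) c * ceval (massP R N) c)))
  + \sum_(k < n) (- 4 * ceval (lcoef (lmul (Lv R N) (Lvxbar R N)) 0) c).
  rewrite ceval_euler -sum_conj_lcoef (eq_bigr _ (fun k _ => wirtinger_fieldP k c)).
  rewrite (mulr_sumr _ _ _ 2) -!big_split /= -!sumrB mulr_sumr -big_split /=.
  by apply: eq_bigr => k _; rewrite mulNr.
have realnat (m : nat) : (m%:R : R[i]) \is Num.real by exact: realn.
have -> : \sum_(k < n) (- 4 * ceval (lcoef (lmul (Lv R N) (Lvxbar R N)) 0) c) =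
    \sum_(k < n) (- 4)%:C * ceval (lcoef (lmul (Lv R N) (Lvxbar R N)) 0) c.
  by apply: eq_bigr => k _; rewrite rmorphN rmorph_nat.
have vvx0 : \sum_(k < n) complex.Re ((- 4)%:C * ceval (lcoef (lmul (Lv R N) (Lvxbar R N)) 0) c) = 0.
  apply: big1 => k _; have := Re_fourier_vvx c; rewrite fourier_lev.
  by case: (ceval _ _) => a b /= ->; rewrite mulr0 mul0r subr0.
rewrite ReD -(sum_Re _ (fun=> _)) vvx0 addr0.
rewrite Re_iM// ceval_psiP ceval_massP.
have h4 := cubic_vbar_real c.
apply: rpredB; first apply: rpredB.
- apply: rpred_sum => k _; apply: rpredD; first by apply: rpredM => //; exact: imode_sqr_real.
  apply: rpredM; first by rewrite rpredV.
  by apply: rpredM => //; exact: fourier_abs4_real.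
- apply: rpredD; first exact: euler_psiP_real.
  by apply: rpred_sum => k _; apply: rpredM => //; exact: real_complexR.
- apply: rpredD; first exact: rpredM.
  apply: rpred_sum => k _; apply: rpredM => //.
  by apply: rpredM; exact: real_complexR.
Qed.
End schroedinger_liouville.

Definition realified_field (R : realType) (N : nat) (i : 'I_(2 * N).+1 + 'I_(2 * N).+1) :
    rpoly R (2 * N).+1 :=
  match i with inl k => (fieldP R k).1 | inr k => (fieldP R k).2 end.

Theorem lemma4p1 (R : realType) (N : nat) (hN : (0 < N)%N)
  (Phi : R -> coefs R N -> coefs R N) (hPhi : is_flow Phi) :
  invariant_under Phi.
Proof.
(* The contributions of [inl k] and [inr k] add up to the real part of $\overline{c_k}F_k$; in the
   divergence they add up to the real part of [wirtinger k]. *)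
have cons x : \sum_i coord i x * peval (@realified_field R N i) x = 0.
  rewrite -[RHS](field_conserves_mass x) big_sumType /= -big_split; apply: eq_bigr => k _ /=.
  by ring.
have div x : \sum_i peval (pder i (@realified_field R N i)) x = 0.
  by rewrite -[RHS](field_divergence_free x) big_sumType /= -big_split.
have Phi0 x : Phi 0 x = x by have [] := hPhi x.
have sol x : solves (@realified_field R N) (Phi ^~ x).
  have [_ sx] := hPhi x => t [k|k]; have [hr hi] := sx t k.
    by move: hr; rewrite ode_fieldE.
  by move: hi; rewrite ode_fieldE.
move=> t; split; first exact: (measurable_flow cons Phi0 sol t).
by move=> A mA; exact: (flow_invariant cons div Phi0 sol t mA).
Qed.
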